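(* Let $G$ be a graph with an induced path $acdb$ such that $c$ and $d$ are adjacent to no vertices other than their neighbors on this path. Let $H$ be the graph obtained from $G\setminus\{c,d\}$ by adding two new vertices $c'$, $d'$ and the paths $ac'b$ and $ad'b$. Then $G$ is minor-minimal with respect to having maximum matching width at least $3$ and not $3$-connected if and only if $H$ is minor-minimal with respect to having maximum matching width at least $3$ and not $3$-connected.
   Context: All graphs are finite and simple. A graph is $k$-connected if it has at least $k$ vertices and remains connected after deleting any fewer than $k$ vertices. A graph $G$ is minor-minimal with respect to having maximum matching width at least $3$ if $\operatorname{mmw}(G)\ge 3$ and every proper minor of $G$ has maximum matching width at most $2$. $\operatorname{mmw}(G)$ is the minimum, over branch-decompositions $(T,\mathcal{L})$ of $V(G)$ (with $T$ a tree all of whose vertices have degree $1$ or $3$ and $\mathcal{L}$ a bijection from its leaves to $V(G)$), of the maximum over edges $e$ of $T$ of the size of a maximum matching in $G$ among edges crossing the vertex partition induced by $e$. *)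

(* Defs.v *)
From mathcomp Require Import all_boot.
From mathcomp Require Import boolp.

Set Implicit Arguments.
Unset Strict Implicit.
Unset Printing Implicit Defensive.

Record sgraph := SGraph {
  vertex :> finType;
  edge : rel vertex;
  edge_sym : symmetric edge;
  edge_irr : irreflexive edge }.

Notation "x -- y" := (edge x y) (at level 30).

Section Operations.
Variable G : sgraph.
Implicit Types (A S : {set G}) (u v : G).

Definition induced_rel A : rel {x : G | x \in A} :=
  [rel x y | val x -- val y].
Fact induced_sym A : symmetric (@induced_rel A).
Proof. by move=> x y; exact: edge_sym. Qed.
Fact induced_irr A : irreflexive (@induced_rel A).
Proof. by move=> x; exact: edge_irr. Qed.
Definition induced A := SGraph (@induced_sym A) (@induced_irr A).

Definition del_vertices S := induced (~: S).

Definition del_edge_rel u v : rel G :=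
  [rel x y | x -- y && ([set x; y] != [set u; v])].
Fact del_edge_sym u v : symmetric (del_edge_rel u v).
Proof. by move=> x y; rewrite /del_edge_rel /= edge_sym setUC. Qed.
Fact del_edge_irr u v : irreflexive (del_edge_rel u v).
Proof. by move=> x; rewrite /del_edge_rel /= edge_irr. Qed.
Definition del_edge u v := SGraph (@del_edge_sym u v) (@del_edge_irr u v).

(* Contraction of the edge uv: v disappears and u stands for the merged       *)
(* vertex; the loop and parallel edges that could arise are discarded.        *)
Definition contract_rel u v : rel {x : G | x \in [set~ v]} :=
  [rel x y | (x != y) &&
     [|| val x -- val y,
         (val x == u) && v -- val y
       | (val y == u) && v -- val x]].
Fact contract_sym u v : symmetric (@contract_rel u v).
Proof.
by move=> x y; rewrite /contract_rel /= eq_sym (edge_sym (val x)) [X in _ || X]orbC.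
Qed.
Fact contract_irr u v : irreflexive (@contract_rel u v).
Proof. by move=> x; rewrite /contract_rel /= eqxx. Qed.
Definition contract u v := SGraph (@contract_sym u v) (@contract_irr u v).

End Operations.

(* proper_minor H G: H arises from G by one or more vertex deletions, edge    *)
(* deletions and edge contractions.                                           *)
Inductive minor_step (G : sgraph) : sgraph -> Prop :=
  | StepDelVertex (v : G) : minor_step G (del_vertices [set v])
  | StepDelEdge (u v : G) : u -- v -> minor_step G (del_edge u v)
  | StepContract (u v : G) : u -- v -> minor_step G (contract u v).

Inductive proper_minor (H G : sgraph) : Prop :=
  | ProperMinor1 : minor_step G H -> proper_minor H G
  | ProperMinorS (K : sgraph) :
      minor_step G K -> proper_minor H K -> proper_minor H G.

Definition connected (G : sgraph) : Prop :=
  0 < #|G| /\ forall x y : G, connect (@edge G) x y.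

Definition kconnected (k : nat) (G : sgraph) : Prop :=
  k <= #|G| /\ forall S : {set G}, #|S| < k -> connected (del_vertices S).

Definition is_tree (G : sgraph) : Prop :=
  connected G /\ forall s : seq G, ucycle (@edge G) s -> size s <= 2.

Definition degree (G : sgraph) (x : G) : nat := #|[set y | x -- y]|.

Definition leaf (T : sgraph) : finType := {x : T | degree x == 1}.

Record branch_decomposition (G : sgraph) := BranchDecomposition {
  bd_tree : sgraph;
  bd_is_tree : is_tree bd_tree;
  bd_degree : forall t : bd_tree, degree t \in [:: 1; 3];
  bd_leaf : leaf bd_tree -> G;
  bd_leaf_bij : bijective bd_leaf }.

Definition crossing_edges (G : sgraph) (A : {set G}) : {set {set G}} :=
  [set [set x; y] | x in A, y in ~: A & x -- y].

Definition max_crossing_matching (G : sgraph) (A : {set G}) : nat :=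
  \max_(M : {set {set G}} | (M \subset crossing_edges A) && trivIset M) #|M|.

(* The side containing u of the partition of V(G) induced by the tree edge uv *)
Definition bd_side (G : sgraph) (D : branch_decomposition G)
    (u v : bd_tree D) : {set G} :=
  [set bd_leaf l | l in [set l : leaf (bd_tree D) |
                          connect (@edge (del_edge u v)) u (val l)]].

Definition bd_width (G : sgraph) (D : branch_decomposition G) : nat :=
  \max_(p : bd_tree D * bd_tree D | p.1 -- p.2)
    max_crossing_matching (bd_side p.1 p.2).

(* A tree with all degrees 1 or 3 has at least two leaves, so a graph with at *)
(* most one vertex has no branch-decomposition; its width is 0 by convention. *)
Definition mmw (G : sgraph) : nat :=
  match pselect (exists k, `[< exists D : branch_decomposition G,
                                 bd_width D = k >]) with
  | left ex_width => ex_minn ex_width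
  | right _ => 0
  end.

Definition minor_minimal_mmw3 (G : sgraph) : Prop :=
  3 <= mmw G /\ forall H : sgraph, proper_minor H G -> mmw H <= 2.

(* The sequence s lists the vertices of an induced path in order. *)
Definition induced_path (G : sgraph) (s : seq G) : Prop :=
  uniq s /\
  {in s &, forall x y,
     x -- y = (index y s == (index x s).+1) || (index x s == (index y s).+1)}.

Section Replacement.
Variables (G : sgraph) (a b c d : G).

(* The two new vertices c' and d' are inr true and inr false. *)
Definition replace_rel : rel (del_vertices [set c; d] + bool)%type :=
  fun x y => match x, y with
  | inl u, inl v => u -- v
  | inl u, inr _ => val u \in [set a; b]
  | inr _, inl v => val v \in [set a; b]
  | inr _, inr _ => false
  end.
Fact replace_sym : symmetric replace_rel.
Proof. by case=> x [] y //; exact: edge_sym. Qed.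
Fact replace_irr : irreflexive replace_rel.
Proof. by case=> x //; exact: edge_irr. Qed.
Definition replace_by_two_paths := SGraph replace_sym replace_irr.

End Replacement.

(* Main.v *)
Require Import Defs.
From mathcomp Require Import all_boot.
From mathcomp Require Import zify.
From mathcomp Require Import boolp.

Set Implicit Arguments.
Unset Strict Implicit.
Unset Printing Implicit Defensive.

(** Neither graph is ever 3-connected, because c in G and c' in H have degree
    two, so the statement is about minor-minimality alone.

    By König's theorem a branch-decomposition of width at most 2 is a binary
    tree over V(G) all of whose cuts have a vertex cover of size at most 2.
    Let G0 be G without c and d.  Both "mmw G <= 2" and "mmw H <= 2" turn out to
    be equivalent to the same property of (G0, a, b): V(G0) splits into two parts
    carrying binary trees in which every cut, seen from below, has a cover of
    size at most 2 that contains those of a and b lying below ([core]); the two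
    new vertices hang on the edge joining the two trees.  To find the splitting
    edge in a given tree, take covers of minimum size that lean to the lower
    side as much as possible, so that covers of nested cuts are compatible, root
    the tree at the leaf a and walk down to the leaf b.  If some cut on the way
    has neither a nor b in its cover, then the cover uses a new vertex, which can
    be traded for a or for b.  Otherwise the walk goes from cuts covered by a
    to cuts covered by b at a branching vertex ([tripod]); the three covers there
    have size at most 2, and not all of them can contain a vertex
    outside a, b and the new vertices, so the splitting edge is one of the
    three.

    Minor operations inside G0 commute with the replacement.  The other single
    steps lead to graphs obtained by adding pendant pieces to subgraphs of
    G0 + (a-x-b), or to subgraphs of G0 + (a-x-b) + ab, which the same walk
    handles. *)

(** * Binary trees over a set and covers of cuts *)

(** A rooted binary tree with leaf labels [A] is recorded only through the label sets of its
    subtrees. [obuilt] also admits the empty tree, to which a tree may shrink when it is pulled back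
    along a map. *)
Inductive built (V : finType) (P : {set V} -> Prop) : {set V} -> Prop :=
  | built1 v : P [set v] -> built P [set v]
  | builtU A B : built P A -> built P B -> [disjoint A & B] ->
      P (A :|: B) -> built P (A :|: B).

Definition obuilt (V : finType) (P : {set V} -> Prop) (A : {set V}) : Prop :=
  A = set0 \/ built P A.

Section Built.
Variable V : finType.
Implicit Types (P : {set V} -> Prop) (A B : {set V}).

Lemma built_prop P A : built P A -> P A.
Proof. by case. Qed.

Lemma built_neq0 P A : built P A -> A != set0.
Proof.
elim=> [v _|A1 B _ + _ _ _ _]; first by apply/set0Pn; exists v; rewrite inE.
by case/set0Pn=> x xA; apply/set0Pn; exists x; rewrite inE xA.
Qed.

Lemma obuilt_neq0 P A : A != set0 -> obuilt P A -> built P A.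
Proof. by move=> /eqP A0 []. Qed.

Lemma obuiltU P A B : obuilt P A -> obuilt P B -> [disjoint A & B] ->
  P (A :|: B) -> obuilt P (A :|: B).
Proof.
case=> [->|bA] [->|bB]; rewrite ?set0U ?setU0 => dAB PAB.
- by left.
- by right.
- by right.
- by right; apply: builtU.
Qed.

Lemma built_sub P Q A : built P A ->
  (forall B, B \subset A -> P B -> Q B) -> built Q A.
Proof.
elim=> [v Pv|A1 B _ IHA _ IHB dAB PAB] PQ; first exact/built1/PQ.
apply: builtU => //; last exact: PQ.
  by apply: IHA => C CA; apply: PQ; apply: subset_trans CA (subsetUl _ _).
by apply: IHB => C CB; apply: PQ; apply: subset_trans CB (subsetUr _ _).
Qed.

Lemma built_all P A : (forall B, P B) -> A != set0 -> built P A.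
Proof.
move=> PT; have [n] := ubnP #|A|; elim: n A => // n IHn A.
rewrite ltnS => leA /set0Pn[x xA].
have [A1|A1] := eqVneq (A :\ x) set0.
  have -> : A = [set x] by rewrite -(setD1K xA) A1 setU0.
  exact: built1.
rewrite -(setD1K xA); apply: builtU => //; first exact: built1.
  by apply: IHn => //; rewrite [#|A|](cardsD1 x) xA in leA.
by rewrite disjoints1 !inE eqxx.
Qed.

(** Walk from the root down to the leaf [x]. What lies above a child [A1] with sibling [B] is what
    lay above the parent, joined with [B]; closure of [P] under complements makes this set
    admissible. *)
Lemma built_reroot P A x : (forall B, P B -> P (~: B)) ->
  built P A -> x \in A -> obuilt P (~: A) -> obuilt P (~: [set x]).
Proof.
move=> PC; elim=> [v _|A1 B bA IHA bB IHB dAB PAB].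
  by rewrite inE => /eqP->.
have eA (C D : {set V}) : [disjoint C & D] -> ~: C = ~: (C :|: D) :|: D.
  move=> dCD; apply/setP=> y; rewrite !inE.
  have := disjointFr dCD (x := y).
  by case: (y \in C) => [/(_ isT)->|_]; case: (y \in D).
have dC (C D : {set V}) : [disjoint ~: (C :|: D) & D].
  by rewrite -setI_eq0; apply/eqP/setP=> y; rewrite !inE; case: (y \in D); rewrite ?orbT ?andbF.
rewrite inE => /orP[xA|xB] oAB.
  apply: IHA => //; rewrite (eA _ B) //.
  apply: obuiltU oAB (or_intror bB) (dC _ _) _.
  by rewrite -eA //; exact/PC/(built_prop bA).
rewrite disjoint_sym in dAB; rewrite setUC in oAB.
apply: IHB => //; rewrite (eA _ A1) //.
apply: obuiltU oAB (or_intror bA) (dC _ _) _.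
by rewrite -eA //; exact/PC/(built_prop bB).
Qed.

End Built.

(** Each leaf is replaced by a tree over its fibre, and branches with empty preimage are pruned. *)
Lemma obuilt_preim (V W : finType) (f : W -> V) (P : {set V} -> Prop)
    (Q : {set W} -> Prop) (A : {set V}) :
  built P A ->
  (forall v, v \in A -> obuilt Q (f @^-1: [set v])) ->
  (forall B : {set V}, B \subset A -> P B -> Q (f @^-1: B)) -> obuilt Q (f @^-1: A).
Proof.
elim=> [v Pv|A1 B _ IHA _ IHB dAB PAB] Qf PQ.
  by apply: Qf; rewrite inE.
rewrite preimsetU; apply: obuiltU.
- apply: IHA => [v vA|C CA]; first by apply: Qf; rewrite inE vA.
  by apply: PQ; apply: subset_trans CA (subsetUl _ _).
- apply: IHB => [v vA|C CA]; first by apply: Qf; rewrite inE vA orbT.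
  by apply: PQ; apply: subset_trans CA (subsetUr _ _).
- rewrite -setI_eq0 -preimsetI; move: dAB; rewrite -setI_eq0 => /eqP->.
  by rewrite preimset0.
- by rewrite -preimsetU; apply: PQ.
Qed.

Section Cover.
Variable G : sgraph.
Implicit Types (A B C D R : {set G}) (k : nat).

Definition cut_cover A C :=
  [forall x in A, forall y in ~: A, x -- y ==> (x \in C) || (y \in C)].

Lemma cut_coverP A C :
  reflect (forall x y, x \in A -> y \notin A -> x -- y -> (x \in C) || (y \in C))
          (cut_cover A C).
Proof.
apply: (iffP forall_inP) => [h x y xA yA xy|h x xA].
  by have /forall_inP/(_ y) := h x xA; rewrite inE yA => /(_ isT) /implyP->.
by apply/forall_inP=> y; rewrite inE => yA; apply/implyP; exact: h.
Qed.

Lemma cut_coverC A C : cut_cover A C -> cut_cover (~: A) C.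
Proof.
move=> /cut_coverP h; apply/cut_coverP=> x y; rewrite !inE negbK => xA yA.
by rewrite edge_sym orbC; apply: h.
Qed.

Lemma cut_cover_super A C D : C \subset D -> cut_cover A C -> cut_cover A D.
Proof.
move=> /subsetP sCD /cut_coverP h; apply/cut_coverP=> x y xA yA /(h _ _ xA yA).
by case/orP=> /sCD->; rewrite ?orbT.
Qed.

Lemma cut_cover_id A : cut_cover A A.
Proof. by apply/cut_coverP=> x y ->. Qed.

(** The condition on [R] makes a cover robust: any further edge that leaves [A] from a vertex of [R]
    is covered as well. For empty [R] the notion is symmetric under complement and, by König's
    theorem, bounds the matchings across the cut. *)
Definition narrow k R A : Prop :=
  exists C, [/\ #|C| <= k, cut_cover A C & R :&: A \subset C].

Lemma narrowC k A : narrow k set0 A -> narrow k set0 (~: A).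
Proof. by case=> C [kC cC _]; exists C; rewrite kC cut_coverC ?set0I ?sub0set. Qed.

Lemma narrow_small k R A : #|A| <= k -> narrow k R A.
Proof. by move=> kA; exists A; rewrite kA cut_cover_id subsetIr. Qed.

Lemma narrow_free k R A : [disjoint R & A] -> narrow k set0 A -> narrow k R A.
Proof.
rewrite -setI_eq0 => /eqP RA [C [kC cC _]].
by exists C; rewrite kC cC RA sub0set.
Qed.

(* Submodularity of vertex covers: for A \subset B, covers C of the cut A and *)
(* D of the cut B can be exchanged for covers that grow C inside A and D      *)
(* outside B.                                                                 *)
Definition uncross_in A B C D : {set G} :=
  [set x | if x \in A then (x \in C) || (x \in D)
           else if x \in B then x \in C else (x \in C) && (x \in D)].
Definition uncross_out A B C D : {set G} :=
  [set x | if x \in A then (x \in C) && (x \in D)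
           else if x \in B then x \in D else (x \in C) || (x \in D)].

Lemma cardE_sum A : #|A| = \sum_x (x \in A).
Proof. by rewrite -sum1_card big_mkcond; apply: eq_bigr => x _; case: (x \in A). Qed.

Lemma card_uncross A B C D :
  #|uncross_in A B C D| + #|uncross_out A B C D| = #|C| + #|D|.
Proof.
rewrite !cardE_sum -!big_split; apply: eq_bigr => x _ /=; rewrite !inE.
by case: (x \in A); case: (x \in B); case: (x \in C); case: (x \in D).
Qed.

Lemma uncross_inP A B C D : A \subset B -> cut_cover A C -> cut_cover B D ->
  cut_cover A (uncross_in A B C D).
Proof.
move=> /subsetP sAB /cut_coverP hC /cut_coverP hD; apply/cut_coverP=> x y xA yA xy.
rewrite !inE xA (negPf yA); have := hC _ _ xA yA xy.
have [yB|yB] := boolP (y \in B).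
  by case: (x \in C); case: (y \in C); rewrite ?orbT.
have := hD _ _ (sAB _ xA) yB xy.
by case: (x \in C); case: (y \in C); case: (x \in D); case: (y \in D).
Qed.

Lemma uncross_outP A B C D : A \subset B -> cut_cover A C -> cut_cover B D ->
  cut_cover B (uncross_out A B C D).
Proof.
move=> /subsetP sAB /cut_coverP hC /cut_coverP hD; apply/cut_coverP=> x y xB yB xy.
have yA : y \notin A by apply: contra yB; exact: sAB.
rewrite !inE xB (negPf yA) (negPf yB); have := hD _ _ xB yB xy.
have [xA|xA] := boolP (x \in A).
  have := hC _ _ xA yA xy.
  by case: (x \in C); case: (y \in C); case: (x \in D); case: (y \in D).
by case: (x \in D); case: (y \in D); rewrite ?orbT.
Qed.

(* Among the covers of minimum size, mincov A has as many vertices in A as    *)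
(* possible; this tie-breaking makes nested cuts have compatible covers.      *)
Definition mincov A : {set G} :=
  [arg min_(C < A | cut_cover A C) (#|C| * #|G|.+1 + #|A :\: C|)].

Lemma mincovP A : cut_cover A (mincov A) /\
  forall C, cut_cover A C ->
    #|mincov A| * #|G|.+1 + #|A :\: mincov A| <= #|C| * #|G|.+1 + #|A :\: C|.
Proof. by rewrite /mincov; case: arg_minnP; first exact: cut_cover_id. Qed.

Lemma mincov_cover A : cut_cover A (mincov A).
Proof. by case: (mincovP A). Qed.

Lemma mincov_min A C : cut_cover A C -> #|mincov A| <= #|C|.
Proof.
move=> /(proj2 (mincovP A)).
(* The second summand of the weight stays below the factor [#|G|.+1], so weights compare
   lexicographically. *)
have : #|A :\: C| <= #|G| by apply: max_card.
by nia.
Qed.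

Lemma mincov_tie A C : cut_cover A C -> #|C| = #|mincov A| ->
  #|A :\: mincov A| <= #|A :\: C|.
Proof. by move=> /(proj2 (mincovP A)) + eC; rewrite eC leq_add2l. Qed.

Lemma mincov_narrow k R A : narrow k R A -> #|mincov A| <= k.
Proof. by case=> C [kC cC _]; apply: leq_trans (mincov_min cC) kC. Qed.

(** The uncrossed sets cover the same two cuts and have the same total size as two minimum covers,
    so each of them is minimum. *)
Lemma mincov_uncross A B : A \subset B ->
  #|uncross_in A B (mincov A) (mincov B)| = #|mincov A| /\
  #|uncross_out A B (mincov A) (mincov B)| = #|mincov B|.
Proof.
move=> sAB; have := card_uncross A B (mincov A) (mincov B).
have := mincov_min (uncross_inP sAB (mincov_cover A) (mincov_cover B)).
have := mincov_min (uncross_outP sAB (mincov_cover A) (mincov_cover B)).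
by lia.
Qed.

(** [uncross_in] is a minimum cover of the cut [A] that keeps [mincov A] inside [A] and adds the
    part of [mincov B] there; the tie-breaking rule allows no proper gain. *)
Lemma mincov_inner A B : A \subset B -> mincov B :&: A \subset mincov A.
Proof.
move=> sAB; have [e1 _] := mincov_uncross sAB.
have := mincov_tie (uncross_inP sAB (mincov_cover A) (mincov_cover B)) e1.
set D := uncross_in _ _ _ _ => le.
have sD : A :\: D \subset A :\: mincov A.
  apply/subsetP=> x; rewrite /D !inE; case: (x \in A); rewrite ?andbF ?andbT //=.
  by case: (x \in mincov A).
have /eqP eD : A :\: D == A :\: mincov A by rewrite eqEcard sD le.
apply/subsetP=> x; rewrite inE => /andP[xB xA].
by move/setP/(_ x): eD; rewrite /D !inE xA xB orbT /= andbT => /esym/negbFE.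
Qed.

(** By [mincov_inner], [uncross_out] contains [mincov B], and equal sizes make the two equal.
    Outside [B], [uncross_out] contains [mincov A]. *)
Lemma mincov_outer A B : A \subset B -> mincov A :\: B \subset mincov B.
Proof.
move=> sAB; have [_ e2] := mincov_uncross sAB.
set D := uncross_out _ _ _ _ in e2.
have sD : mincov B \subset D.
  apply/subsetP=> x xB; rewrite /D !inE xB.
  have := subsetP (mincov_inner sAB) x; rewrite inE xB.
  by case: (x \in A); case: (x \in B); rewrite ?orbT // => /(_ isT)->.
have /eqP eD : mincov B == D by rewrite eqEcard sD e2 leqnn.
apply/subsetP=> x; rewrite inE => /andP[xB xA].
have xA' : x \notin A by apply: contra xB; apply: (subsetP sAB).
by rewrite eD /D !inE (negPf xA') (negPf xB) xA.
Qed.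

End Cover.

(** * König's theorem and sides of tree edges *)

Section Koenig.
Variable G : sgraph.
Implicit Types (A C : {set G}) (e : {set G}) (E M : {set {set G}}).

Lemma crossing_edgesP A e :
  reflect (exists x y, [/\ x \in A, y \notin A, x -- y & e = [set x; y]])
          (e \in crossing_edges A).
Proof.
apply: (iffP imset2P) => [[x y xA]|[x [y [xA yA xy ->]]]].
  by rewrite !inE => /andP[yA xy] ->; exists x, y.
by exists x y => //; rewrite !inE yA.
Qed.

Lemma crossing_edgesC A : crossing_edges (~: A) = crossing_edges A.
Proof.
suff sub (B : {set G}) : crossing_edges B \subset crossing_edges (~: B).
  by apply/eqP; rewrite eqEsubset sub andbT -{2}(setCK A) sub.
apply/subsetP=> e /crossing_edgesP[x [y [xB yB xy ->]]].
by apply/crossing_edgesP; exists y, x; rewrite !inE negbK edge_sym setUC.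
Qed.

Lemma crossing_edge_at A e x : e \in crossing_edges A -> x \in e -> x \in A ->
  exists2 y, y \notin A & e = [set x; y].
Proof.
case/crossing_edgesP=> u [v [uA vA _ ->]]; rewrite !inE => /orP[] /eqP-> xA.
  by exists v.
by rewrite xA in vA.
Qed.

Definition meets C e := [exists x in e, x \in C].

Lemma meets2 C x y : meets C [set x; y] = (x \in C) || (y \in C).
Proof.
apply/exists_inP/orP => [[z]|[xC|yC]].
- by rewrite !inE => /orP[]/eqP-> ->; [left|right].
- by exists x; rewrite ?inE ?eqxx.
- by exists y; rewrite ?inE ?eqxx ?orbT.
Qed.

(* If two edges share a vertex x, covers of the edge sets missing one of them *)
(* uncross into covers of E, the smaller one after adding x.                  *)
Lemma koenig_edges E A : E \subset crossing_edges A ->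
  exists C M, [/\ {in E, forall e, meets C e}, M \subset E, trivIset M & #|C| <= #|M|].
Proof.
have [n] := ubnP #|E|; elim: n E A => // n IHn E A; rewrite ltnS => leE EA.
have [tE|] := boolP (trivIset E).
  have [E0|/set0Pn[e0 e0E]] := eqVneq E set0.
    by exists set0, set0; rewrite E0 !cards0; split=> [e|||] //;
      rewrite ?inE //; apply/trivIsetP=> ? ?; rewrite inE.
  (* If [E] is itself a matching, one vertex picked from each edge gives a cover; [x0] is only the
     default of the choice. *)
  have /crossing_edgesP[x0 _] := subsetP EA _ e0E.
  exists [set odflt x0 [pick x in e] | e : {set G} in E], E.
  split=> //; last exact: leq_imset_card.
  move=> e eE; have /crossing_edgesP[x [y [_ _ _ ee]]] := subsetP EA _ eE.
  apply/exists_inP; exists (odflt x0 [pick x in e]); last exact: imset_f.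
  by case: pickP => //= /(_ x); rewrite ee !inE eqxx.
move=> ntE; have [e1 [e2 [e1E e2E ne12 [x x1 x2]]]] : exists e1 e2,
    [/\ e1 \in E, e2 \in E, e1 != e2 & exists2 x, x \in e1 & x \in e2].
  apply: contrapT => no; case/negP: ntE; apply/trivIsetP=> e1 e2 e1E e2E ne12.
  apply/pred0P=> x /=; apply/negP=> /andP[x1 x2]; apply: no.
  by exists e1, e2; split=> //; exists x.
wlog xA : A EA / x \in A => [hw|].
  have [|xA] := boolP (x \in A); first exact: hw.
  by apply: (hw (~: A)); rewrite ?crossing_edgesC // inE.
have [y yA e1y] := crossing_edge_at (subsetP EA _ e1E) x1 xA.
have [z zA e2z] := crossing_edge_at (subsetP EA _ e2E) x2 xA.
have IH e : e \in E -> exists C M, [/\ {in E :\ e, forall e', meets C e'},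
    M \subset E, trivIset M & #|C| <= #|M|].
  move=> eE; case: (IHn (E :\ e) A) => [||C [M [hC ME tM CM]]].
  - by rewrite (cardsD1 e E) eE in leE.
  - exact: subset_trans (subsetDl _ _) EA.
  - by exists C, M; split=> //; apply: subset_trans ME (subsetDl _ _).
have [C1 [M1 [h1 M1E tM1 CM1]]] := IH _ e1E.
have [C2 [M2 [h2 M2E tM2 CM2]]] := IH _ e2E.
have [m1|n1] := boolP (meets C1 e1).
  exists C1, M1; split=> // e eE; have [->//|ne] := eqVneq e e1.
  by apply: h1; rewrite !inE ne.
have [m2|n2] := boolP (meets C2 e2).
  exists C2, M2; split=> // e eE; have [->//|ne] := eqVneq e e2.
  by apply: h2; rewrite !inE ne.
move: n1 n2; rewrite e1y e2z !meets2 !negb_or => /andP[x1' y1] /andP[x2' z2].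
have zC1 : z \in C1.
  by have := h1 e2; rewrite !inE eq_sym ne12 e2E e2z meets2 (negPf x1') => /(_ isT).
have yC2 : y \in C2.
  by have := h2 e1; rewrite !inE ne12 e1E e1y meets2 (negPf x2') => /(_ isT).
(* Here [e1] is [xy] and [e2] is [xz], with [y] in [C2] and [z] in [C1]. [Cout] takes unions outside
   [A], so it contains both [y] and [z]; [Cin] meets [e1] and [e2] once [x] is added. *)
pose Cout := uncross_out A A C1 C2; pose Cin := uncross_in A A C1 C2.
have hE e : e \in E -> e != e1 -> e != e2 -> exists u v,
    [/\ u \in A, v \notin A, e = [set u; v], (u \in C1) || (v \in C1)
      & (u \in C2) || (v \in C2)].
  move=> eE ne1 ne2; have /crossing_edgesP[u [v [uA vA _ ee]]] := subsetP EA _ eE.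
  exists u, v; split=> //; rewrite -meets2 -ee.
    by apply: h1; rewrite !inE ne1.
  by apply: h2; rewrite !inE ne2.
have hout : {in E, forall e, meets Cout e}.
  move=> e eE; have [->|ne1] := eqVneq e e1.
    by rewrite e1y meets2 !inE (negPf yA) yC2 !orbT.
  have [->|ne2] := eqVneq e e2.
    by rewrite e2z meets2 !inE (negPf zA) zC1 !orbT.
  have [u [v [uA vA -> c1 c2]]] := hE e eE ne1 ne2.
  rewrite meets2 !inE uA (negPf vA); move: c1 c2.
  by case: (u \in C1); case: (u \in C2); case: (v \in C1).
have hin : {in E, forall e, meets (x |: Cin) e}.
  move=> e eE; have [->|ne1] := eqVneq e e1.
    by rewrite e1y meets2 !inE eqxx.
  have [->|ne2] := eqVneq e e2.
    by rewrite e2z meets2 !inE eqxx.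
  have [u [v [uA vA -> c1 c2]]] := hE e eE ne1 ne2.
  rewrite meets2 !inE uA (negPf vA); move: c1 c2.
  by case: (u \in C1); case: (u \in C2); case: (v \in C1); case: (v \in C2);
    rewrite ?orbT.
(* The sizes of [Cin] and [Cout] add up to at most [#|M1| + #|M2|]. If [Cout] exceeds the larger
   matching, then [Cin] is smaller than that matching and has room for [x]. *)
have cE := card_uncross A A C1 C2; rewrite -/Cin -/Cout in cE.
have cx : #|x |: Cin| <= #|Cin|.+1 by rewrite cardsU1; case: (x \notin Cin).
have [leM|ltM] := leqP #|M1| #|M2|.
  have [le|lt] := leqP #|Cout| #|M2|; first by exists Cout, M2.
  exists (x |: Cin), M2; split=> //; move: cE cx CM1 CM2 leM lt; clear; lia.
have [le|lt] := leqP #|Cout| #|M1|; first by exists Cout, M1.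
exists (x |: Cin), M1; split=> //; move: cE cx CM1 CM2 ltM lt; clear; lia.
Qed.

Lemma koenig A k : max_crossing_matching A <= k -> narrow k set0 A.
Proof.
have [C [M [hC MA tM CM]]] := koenig_edges (subxx (crossing_edges A)).
move=> le; exists C; rewrite set0I sub0set; split=> //.
  apply: leq_trans CM (leq_trans _ le).
  by apply: (bigmax_sup M); rewrite ?MA.
apply/cut_coverP=> x y xA yA xy; rewrite -meets2; apply: hC.
by apply/crossing_edgesP; exists x, y.
Qed.

Lemma cover_matching A C : cut_cover A C -> max_crossing_matching A <= #|C|.
Proof.
move=> /cut_coverP hC; apply/bigmax_leqP=> M /andP[MA tM].
rewrite -sum1_card.
apply: (@leq_trans (\sum_(e in M) \sum_(x in e) (x \in C))).
  apply: leq_sum => e eM.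
  have /crossing_edgesP[x [y [xA yA xy ->]]] := subsetP MA _ eM.
  have /orP[h|h] := hC _ _ xA yA xy.
    by rewrite (bigD1 x) ?inE ?eqxx //= h.
  by rewrite (bigD1 y) ?inE ?eqxx ?orbT //= h.
rewrite -big_trivIset //= cardE_sum [X in _ <= X](bigID (mem (finset.cover M))) /=.
exact: leq_addr.
Qed.

End Koenig.

Section Tree.
Variable T : sgraph.
Implicit Types (u v w x y z : T) (S : {set T}).

Definition component u v : {set T} := [set z | connect (@edge (del_edge u v)) u z].

Lemma component_self u v : u \in component u v.
Proof. by rewrite inE connect0. Qed.

Lemma component_edge u v x y : x \in component u v -> x -- y ->
  [set x; y] != [set u; v] -> y \in component u v.
Proof.
rewrite !inE => ux xy ne; apply: connect_trans ux (connect1 _).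
by rewrite /= /del_edge_rel /= xy.
Qed.

Lemma component_sub u v S : u \in S ->
  (forall x y, x \in S -> x \in component u v -> x -- y ->
     [set x; y] != [set u; v] -> y \in S) ->
  component u v \subset S.
Proof.
move=> uS hS; apply/subsetP=> z; rewrite inE => /connectP[p].
elim/last_ind: p z => [|p y IHp] z /=; first by move=> _ ->.
rewrite rcons_path last_rcons => /andP[pp] /= /andP[e ne] ->.
apply: hS e ne; first exact: IHp.
by rewrite inE; apply/connectP; exists p.
Qed.

Hypothesis treeT : is_tree T.

(** A simple path from [u] to [v] avoiding the edge [uv] would close up with it to a cycle of length
    at least three. *)
Lemma tree_bridge u v : u -- v -> v \notin component u v.
Proof.
move=> uv; rewrite inE; apply/negP=> /connectP[p]; case/shortenP=> q qp uq _ vq.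
have : size (u :: q) <= 2.
  apply: (proj2 treeT); rewrite /ucycle uq andbT /= rcons_path -vq.
  rewrite edge_sym uv andbT.
  by apply: sub_path qp => x y /andP[].
case: q qp uq vq => [|w [|//]] /=.
  by move=> _ _ vu; rewrite vu edge_irr in uv.
by move=> /andP[] /andP[_] + _ _ vw; rewrite vw eqxx.
Qed.

Lemma set2_notin x y u v w : x != w -> y != w -> w \in [set u; v] ->
  [set x; y] != [set u; v].
Proof.
by move=> xw yw; apply: contraTneq => <-; rewrite !inE ![w == _]eq_sym (negPf xw).
Qed.

Lemma set2_eq_or x y u v : [set x; y] = [set u; v] ->
  (x = u /\ y = v) \/ (x = v /\ y = u).
Proof.
move=> e; have : x \in [set u; v] by rewrite -e !inE eqxx.
have : y \in [set u; v] by rewrite -e !inE eqxx orbT.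
have : u \in [set x; y] by rewrite e !inE eqxx.
have : v \in [set x; y] by rewrite e !inE eqxx orbT.
rewrite !inE.
by do 4!case/orP=> /eqP ?; subst; auto.
Qed.

Lemma component_child u v w : u -- v -> u -- w -> w != v ->
  component w u \subset component u v.
Proof.
move=> uv uw wv; have wu : w -- u by rewrite edge_sym.
have unw := tree_bridge wu.
apply: component_sub => [|x y xC xW xy ne].
  apply: component_edge (component_self _ _) uw _.
  by apply: contra_neq wv => /set2_eq_or; intuition congruence.
have yW := component_edge xW xy ne.
apply: component_edge xC xy _; apply: (@set2_notin _ _ _ _ u).
- by apply: contraTneq xW => ->.
- by apply: contraTneq yW => ->.
- by rewrite !inE eqxx.
Qed.

Lemma component_disjoint u w1 w2 : u -- w1 -> u -- w2 -> w1 != w2 ->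
  [disjoint component w1 u & component w2 u].
Proof.
move=> uw1 uw2 ne12; rewrite disjoints_subset.
have u1 : u \notin component w1 u by rewrite tree_bridge 1?edge_sym.
have u2 : u \notin component w2 u by rewrite tree_bridge 1?edge_sym.
apply: component_sub => [|x y].
  rewrite in_setC; apply: contra u2 => w1W; apply: (component_edge w1W).
    by rewrite edge_sym.
  by apply: contra_neq ne12 => /set2_eq_or; intuition congruence.
rewrite !in_setC => xW2 xW1 xy ne; apply: contra xW2 => yW2.
have yW1 := component_edge xW1 xy ne.
apply: (component_edge yW2); rewrite 1?edge_sym //; apply: (@set2_notin _ _ _ _ u).
- by apply: contraTneq yW1 => ->.
- by apply: contraTneq xW1 => ->.
- by rewrite !inE eqxx orbT.
Qed.

Lemma component_split u v : component u v \subset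
  u |: \bigcup_(w | (u -- w) && (w != v)) component w u.
Proof.
have wB x w : x \in component w u -> (u -- w) && (w != v) ->
    x \in u |: \bigcup_(w | (u -- w) && (w != v)) component w u.
  by move=> xw uw; rewrite in_setU; apply/orP; right; apply/bigcupP; exists w.
apply: component_sub => [|x y]; first by rewrite in_setU1 eqxx.
rewrite in_setU1 => /orP[/eqP->|/bigcupP[w uw xw]] _ xy ne.
  apply: (wB _ y); first exact: component_self.
  by rewrite xy; apply: contra_neq ne => ->.
have [e|ne'] := eqVneq [set x; y] [set w; u]; last exact: wB (component_edge xw xy ne') uw.
have [[_ ->]|[_ ->]] := set2_eq_or e; first by rewrite in_setU1 eqxx.
exact: wB (component_self _ _) uw.
Qed.

Lemma componentC u v : u -- v -> ~: component u v = component v u.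
Proof.
move=> uv; have vu : v -- u by rewrite edge_sym.
have unv := tree_bridge vu; have vnu := tree_bridge uv.
apply/eqP; rewrite eqEsubset; apply/andP; split; last first.
  apply: component_sub => [|x y]; first by rewrite in_setC.
  rewrite !in_setC => xU xV xy ne; apply: contra xU => yU.
  by apply: (component_edge yU); rewrite 1?edge_sym // setUC [X in _ != X]setUC.
apply/subsetP=> z; rewrite in_setC.
suff : z \in component u v :|: component v u by rewrite in_setU => /orP[->|].
have /connectP[p pp ->] := proj2 (proj1 treeT) u z.
suff cl x : x \in component u v :|: component v u -> path (@edge T) x p ->
    last x p \in component u v :|: component v u.
  by apply: cl pp; rewrite in_setU component_self.
elim: p x {pp} => //= y p IHp x xI /andP[xy yp].
apply: IHp _ yp; have [e|ne] := eqVneq [set x; y] [set u; v].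
  by have [[_ ->]|[_ ->]] := set2_eq_or e; rewrite in_setU component_self ?orbT.
move: xI; rewrite !in_setU => /orP[xI|xI]; first by rewrite (component_edge xI xy ne).
by rewrite orbC (component_edge xI xy) // [X in _ != X]setUC.
Qed.

End Tree.

Section Sides.
Variables (G : sgraph) (D : branch_decomposition G).
Implicit Types (u v : bd_tree D).

Lemma mem_bd_side u v (l : leaf (bd_tree D)) :
  (bd_leaf l \in bd_side u v) = (val l \in component u v).
Proof.
rewrite mem_imset; last exact: bij_inj (bd_leaf_bij D).
by rewrite [in LHS]inE [in RHS]inE.
Qed.

Lemma bd_side_eq u v (A : {set G}) :
  (forall l : leaf (bd_tree D), (bd_leaf l \in A) = (val l \in component u v)) ->
  bd_side u v = A.
Proof.
move=> h; have [g _ gK] := bd_leaf_bij D.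
by apply/setP=> x; rewrite -(gK x) mem_bd_side h.
Qed.

Lemma bd_sideC u v : u -- v -> bd_side v u = ~: bd_side u v.
Proof.
move=> uv; apply: bd_side_eq => l.
by rewrite in_setC mem_bd_side -(componentC (bd_is_tree D) uv) in_setC.
Qed.

Lemma degreeE (T : sgraph) (u v : T) : u -- v ->
  degree u = #|[set w | (u -- w) && (w != v)]|.+1.
Proof.
move=> uv; rewrite /degree (cardsD1 v) inE uv add1n; congr _.+1.
by apply: eq_card => w; rewrite !inE andbC.
Qed.

(** Induction on the component of [u]: if [u] is a leaf, its side is a singleton, and otherwise the
    side splits over the two neighbours of [u] other than [v]. König's theorem turns the width into
    covers. *)
Lemma bd_side_built k u v : bd_width D <= k -> u -- v ->
  built (narrow k set0) (bd_side u v).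
Proof.
move=> wD; have [n] := ubnP #|component u v|; elim: n u v => // n IHn u v.
rewrite ltnS => len uv; have tD := bd_is_tree D.
have wuv : narrow k set0 (bd_side u v).
  apply/koenig/(leq_trans _ wD).
  exact: (bigmax_sup (u, v)).
have wu w : u -- w -> w -- u by rewrite edge_sym.
have unw w : u -- w -> u \notin component w u by move=> uw; apply/tree_bridge/wu.
have szu w : u -- w -> w != v -> #|component w u| < n.
  move=> uw wv; apply: leq_trans len; apply: proper_card; rewrite properE.
  rewrite component_child //=; apply/subsetPn.
  by exists u; [exact: component_self|exact: unw].
have := bd_degree u; rewrite !inE (degreeE uv) eqSS => /orP[d1|].
  have lu : degree u == 1 by rewrite (degreeE uv) eqSS.
  have e : bd_side u v = [set bd_leaf (exist _ u lu)].
    apply: bd_side_eq => l; rewrite inE (inj_eq (bij_inj (bd_leaf_bij D))).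
    apply/eqP/idP => [->|]; first exact: component_self.
    move/(subsetP (component_split _ _)); rewrite in_setU1 => /orP[/eqP e|].
      exact: val_inj.
    by case/bigcupP=> w; move/eqP/cards0_eq/setP/(_ w): d1; rewrite !inE => ->.
  by rewrite e in wuv *; apply: built1.
rewrite eqSS => d3; have /cards2P[w1 [w2 [ne12 e12]]] := d3.
have uw w : (u -- w) && (w != v) = (w \in [set w1; w2]) by rewrite -e12 inE.
have /andP[uw1 w1v] : (u -- w1) && (w1 != v) by rewrite uw !inE eqxx.
have /andP[uw2 w2v] : (u -- w2) && (w2 != v) by rewrite uw !inE eqxx orbT.
have e : bd_side u v = bd_side w1 u :|: bd_side w2 u.
  apply: bd_side_eq => l; rewrite in_setU !mem_bd_side; apply/orP/idP => [[]|].
  - exact: subsetP (component_child tD uv uw1 w1v) _.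
  - exact: subsetP (component_child tD uv uw2 w2v) _.
  move/(subsetP (component_split _ _)); rewrite in_setU1 => /orP[/eqP e|].
    by have := valP l; rewrite e (degreeE uv) (eqP d3).
  by case/bigcupP=> w; rewrite uw !inE => /orP[]/eqP-> ->; [left|right].
rewrite e; apply: builtU.
- exact: IHn (szu _ uw1 w1v) (wu _ uw1).
- exact: IHn (szu _ uw2 w2v) (wu _ uw2).
- rewrite disjoints_subset; have [g _ gK] := bd_leaf_bij D.
  apply/subsetP=> x; rewrite -(gK x) in_setC !mem_bd_side.
  by move=> h; rewrite (disjointFr (component_disjoint tD uw1 uw2 ne12) h).
- by rewrite -e.
Qed.

(** Any tree edge can be subdivided by a root that joins the trees on its two sides. *)
Lemma bd_built k : bd_width D <= k -> built (narrow k set0) [set: G].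
Proof.
move=> wD; have [[T0 _] _] := bd_is_tree D.
have /card_gt0P[u _] := T0.
have [v uv] : exists v, u -- v.
  have : 0 < degree u by have := bd_degree u; rewrite !inE => /orP[]/eqP->.
  by case/card_gt0P=> v; rewrite inE => uv; exists v.
rewrite -(setUCr (bd_side u v)) -(bd_sideC uv); apply: builtU.
- exact: bd_side_built.
- by apply: bd_side_built; rewrite // edge_sym.
- by rewrite (bd_sideC uv) disjoints_subset setCK.
- exists set0; rewrite cards0 set0I subxx; split=> //.
  by apply/cut_coverP=> x y _; rewrite (bd_sideC uv) setUCr inE.
Qed.

End Sides.

(** * From binary trees to branch-decompositions *)

(* A rooted binary tree hanging below an extra vertex None, with parent map   *)
(* rt_par; rt_set x is the set of leaf labels below x.                        *)
Record rtree (V : finType) (P : {set V} -> Prop) (A : {set V}) := Rtree {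
  rt_node : finType;
  rt_par : rt_node -> option rt_node;
  rt_set : rt_node -> {set V};
  rt_rank : rt_node -> nat;
  rt_rank_lt : forall x y, rt_par x = Some y -> rt_rank y < rt_rank x;
  rt_root : exists r, (forall x, (rt_par x == None) = (x == r)) /\ rt_set r = A;
  rt_sub : forall x, rt_set x \subset A;
  rt_children : forall x, let ch := [set y | rt_par y == Some x] in
    (ch = set0 /\ exists v, rt_set x = [set v]) \/
    (#|ch| = 2 /\ forall v, v \in rt_set x -> exists2 y, y \in ch & v \in rt_set y);
  rt_leaf_inj : forall x y, [set z | rt_par z == Some x] = set0 ->
    [set z | rt_par z == Some y] = set0 -> rt_set x = rt_set y -> x = y;
  rt_prop : forall x, P (rt_set x) }.

Section Join.
Variables (V : finType) (P : {set V} -> Prop).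

Lemma rtree1 v : P [set v] -> inhabited (rtree P [set v]).
Proof.
move=> Pv; constructor.
have ch0 x : [set y : unit | @None unit == Some x] = set0.
  by apply/setP=> y; rewrite !inE.
apply: (@Rtree _ _ _ unit (fun=> None) (fun=> [set v]) (fun=> 0)) => //.
- by exists tt; split=> // -[].
- by move=> x /=; left; split; [exact: ch0|exists v].
- by move=> [] [].
Qed.

Variables (A B : {set V}) (RA : rtree P A) (RB : rtree P B).
Hypothesis dAB : [disjoint A & B].
Hypothesis PAB : P (A :|: B).

(** [None] is the new root, placed above the roots of the two trees. *)
Let N : finType := option (rt_node RA + rt_node RB)%type.
Let par (x : N) : option N :=
  match x with
  | None => None
  | Some (inl y) => Some (omap inl (rt_par y))
  | Some (inr y) => Some (omap inr (rt_par y))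
  end.
Let lab (x : N) : {set V} :=
  match x with
  | None => A :|: B
  | Some (inl y) => rt_set y
  | Some (inr y) => rt_set y
  end.
Let rank (x : N) : nat :=
  match x with
  | None => 0
  | Some (inl y) => (rt_rank y).+1
  | Some (inr y) => (rt_rank y).+1
  end.

Let chl (x : rt_node RA) : [set y | par y == Some (Some (inl x))] =
  (fun z => Some (inl z)) @: [set z | rt_par z == Some x].
Proof.
apply/setP=> y; rewrite inE; apply/eqP/imsetP => [|[z]].
  case: y => [[y|y]|] //=; case e: (rt_par y) => [z|] //= [zx].
  by exists y; rewrite // inE e zx.
by rewrite inE => /eqP e -> /=; rewrite e.
Qed.

Let chr (x : rt_node RB) : [set y | par y == Some (Some (inr x))] =
  (fun z => Some (inr z)) @: [set z | rt_par z == Some x].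
Proof.
apply/setP=> y; rewrite inE; apply/eqP/imsetP => [|[z]].
  case: y => [[y|y]|] //=; case e: (rt_par y) => [z|] //= [zx].
  by exists y; rewrite // inE e zx.
by rewrite inE => /eqP e -> /=; rewrite e.
Qed.

Let chroot : exists rA rB, [set y | par y == Some None] = [set Some (inl rA); Some (inr rB)] /\
  rt_set rA = A /\ rt_set rB = B.
Proof.
have [rA [hA SA]] := rt_root RA; have [rB [hB SB]] := rt_root RB.
exists rA, rB; split=> //; apply/setP=> y; rewrite !inE.
case: y => [[y|y]|] //.
  rewrite [LHS]/= [X in X || _](_ : _ = (y == rA)) ?orbF //.
  by rewrite -hA; case: (rt_par y).
rewrite [LHS]/= [X in _ || X](_ : _ = (y == rB)) //.
by rewrite -hB; case: (rt_par y).
Qed.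

Lemma rtree_join : inhabited (rtree P (A :|: B)).
Proof.
have [rA [rB [chN [SA SB]]]] := chroot.
constructor; apply: (@Rtree _ _ _ N par lab rank).
- move=> [[x|x]|] y //=.
    by case e: (rt_par x) => [z|] //= [<-] //=; rewrite ltnS; apply: rt_rank_lt.
  by case e: (rt_par x) => [z|] //= [<-] //=; rewrite ltnS; apply: rt_rank_lt.
- by exists None; split=> // -[[x|x]|].
- move=> [[x|x]|] //=; first exact: subset_trans (rt_sub x) (subsetUl _ _).
  exact: subset_trans (rt_sub x) (subsetUr _ _).
- move=> [[x|x]|] /=.
  + rewrite chl; case: (rt_children x) => [[-> e]|[c2 h]].
      by left; rewrite imset0.
    right; rewrite card_imset; last by move=> ? ? [].
    split=> // v /h[y yc vy]; exists (Some (inl y)) => //; exact: imset_f.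
  + rewrite chr; case: (rt_children x) => [[-> e]|[c2 h]].
      by left; rewrite imset0.
    right; rewrite card_imset; last by move=> ? ? [].
    split=> // v /h[y yc vy]; exists (Some (inr y)) => //; exact: imset_f.
  + right; rewrite chN cards2; split=> // v; rewrite inE => /orP[vA|vB].
      by exists (Some (inl rA)); rewrite ?inE ?eqxx //= SA.
    by exists (Some (inr rB)); rewrite ?inE ?eqxx ?orbT //= SB.
- have lne (x : rt_node RA) (y : rt_node RB) :
      [set z | rt_par z == Some x] = set0 -> rt_set x = rt_set y -> False.
    move=> e0 exy; case: (rt_children x) => [[_ [v e]]|[]]; last by rewrite e0 cards0.
    have vA : v \in A by apply: (subsetP (rt_sub x)); rewrite e inE.
    have : v \in B by apply: (subsetP (rt_sub y)); rewrite -exy e inE.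
    by rewrite (disjointFr dAB vA).
  have N0 : [set z | par z == Some None] <> set0.
    by rewrite chN => /setP/(_ (Some (inl rA))); rewrite !inE eqxx.
  move=> [[x|x]|] [[y|y]|] //; rewrite ?chl ?chr.
  + move=> /eqP; rewrite imset_eq0 => /eqP x0 /eqP; rewrite imset_eq0 => /eqP y0 /= e.
    by rewrite (rt_leaf_inj x0 y0 e).
  + by move=> /eqP; rewrite imset_eq0 => /eqP x0 _ /= /(lne _ _ x0).
  + by move=> _ /eqP; rewrite imset_eq0 => /eqP y0 /= /esym /(lne _ _ y0).
  + move=> /eqP; rewrite imset_eq0 => /eqP x0 /eqP; rewrite imset_eq0 => /eqP y0 /= e.
    by rewrite (rt_leaf_inj x0 y0 e).
- by move=> [[x|x]|] //=; apply: rt_prop.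
Qed.

End Join.

Lemma built_rtree (V : finType) (P : {set V} -> Prop) A :
  built P A -> inhabited (rtree P A).
Proof.
elim=> [v|A1 B _ [RA] _ [RB] dAB PAB]; first exact: rtree1.
exact: rtree_join RA RB dAB PAB.
Qed.

Section TreeOfRtree.
Variables (G : sgraph) (k : nat) (g : G).
Variable R : rtree (narrow k set0) [set~ g].

Let N := rt_node R.
Let par (t u : option N) := if t is Some x then rt_par x == u else false.

(** The extra vertex [None] becomes the leaf of [g]. It gives the root the upper neighbour that
    every other node has in its parent. *)
Definition rt_edge : rel (option N) := fun t u => par t u || par u t.
Fact rt_edge_sym : symmetric rt_edge.
Proof. by move=> t u; rewrite /rt_edge orbC. Qed.

Let rank (t : option N) := if t is Some x then (rt_rank x).+1 else 0.

Let par_rank t u : par t u -> rank u < rank t.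
Proof.
case: t => [x|] //= /eqP; case: u => [y|] //= e.
by rewrite ltnS; apply: rt_rank_lt.
Qed.

Fact rt_edge_irr : irreflexive rt_edge.
Proof. by move=> t; apply/negP; rewrite /rt_edge orbb => /par_rank; rewrite ltnn. Qed.

Definition rt_graph := SGraph rt_edge_sym rt_edge_irr.

Let par_uniq t u w : par t u -> par t w -> u = w.
Proof. by case: t => [x|] //= /eqP-> /eqP. Qed.

Let par_edge t u : par t u -> edge (t : rt_graph) u.
Proof. by move=> tu; rewrite /= /rt_edge tu. Qed.

(** Ranks drop towards the parent, so every vertex climbs to [None]. On a cycle of length at least
    three, both neighbours of a vertex of maximum rank would be its parent. *)
Lemma rt_is_tree : is_tree rt_graph.
Proof.
split; first split.
- by apply/card_gt0P; exists None.
- have to0 t : connect (@edge rt_graph) t None.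
    have [n] := ubnP (rank t); elim: n t => // n IHn [x|] //; rewrite ltnS => le.
    have px : par (Some x) (rt_par x) by rewrite /= eqxx.
    apply: connect_trans (connect1 (par_edge px)) _; apply: IHn.
    exact: leq_trans (par_rank px) le.
  move=> x y; apply: connect_trans (to0 x) _.
  by rewrite (sym_connect_sym (@edge_sym rt_graph)) to0.
- move=> s us; rewrite leqNgt; apply/negP=> s3.
  have [t0 t0s] : exists t0, t0 \in s.
    by case: s {us} s3 => // t s _; exists t; rewrite inE eqxx.
  have [t ts tmax] := @arg_maxnP _ t0 (mem s) rank t0s.
  have [i s' es] := rot_to ts.
  move: us s3; rewrite -(rot_ucycle i) -(size_rot i) es /ucycle /= => /andP[].
  have up u : u \in t :: s' -> rt_edge t u -> par t u.
    rewrite -es mem_rot => us; case/orP=> // /par_rank.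
    by rewrite ltnNge => /negP[]; exact: tmax.
  case: s' es up => [|y s'] // es up; case/lastP: s' es up => [|s' z] // es up.
  rewrite -rcons_cons rcons_path last_rcons => /andP[pp zt] uq _.
  have ty : par t y by apply: up; [rewrite !inE eqxx orbT|case/andP: pp].
  have tz : par t z.
    by apply: up; [rewrite !inE mem_rcons inE eqxx !orbT|rewrite rt_edge_sym].
  have eyz := par_uniq ty tz; move: uq; rewrite eyz /= mem_rcons inE eqxx /=.
  by rewrite andbF.
Qed.

Let nbr_None r : (forall x : N, (rt_par x == None) = (x == r)) ->
  forall u, edge (None : rt_graph) u = (u == Some r).
Proof. by move=> hr [x|] //=; rewrite /rt_edge /= hr. Qed.

Lemma rt_degree_None : degree (None : rt_graph) = 1.
Proof.
have [r [hr _]] := rt_root R; apply/eqP/cards1P; exists (Some r : rt_graph).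
by apply/setP=> u; rewrite !inE -(nbr_None hr).
Qed.

Lemma rt_degree_Some (x : N) :
  degree (Some x : rt_graph) = #|[set y | rt_par y == Some x]|.+1.
Proof.
have px : par (Some x) (rt_par x) by rewrite /= eqxx.
rewrite (degreeE (par_edge px)); congr _.+1.
have Sinj : injective (@Some N) by move=> ? ? [].
rewrite -(card_imset _ Sinj).
suff -> : [set w : rt_graph | (edge (Some x : rt_graph) w) && (w != rt_par x)] =
  [set Some y | y in [set y : N | rt_par y == Some x]] by [].
apply/setP=> u; rewrite inE; apply/andP/imsetP => [[]|[y]].
  rewrite /= /rt_edge => /orP[/eqP-> /eqP //|]; case: u => [y|] //= yx _.
  by exists y; rewrite ?inE.
rewrite inE => yx ->; split; first by rewrite /= /rt_edge /= yx orbT.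
apply: contraTneq (par_rank px) => <-; rewrite -leqNgt ltnW //.
exact: (@par_rank (Some y) (Some x)).
Qed.

Let leafy (x : N) : bool := [set y | rt_par y == Some x] == set0.

Lemma rt_degree_ok (t : rt_graph) : degree t \in [:: 1; 3].
Proof.
case: t => [x|]; last by rewrite rt_degree_None.
rewrite rt_degree_Some; case: (rt_children x) => [[-> _]|[-> _]] //.
by rewrite cards0.
Qed.

Let deg_leafy x : (degree (Some x : rt_graph) == 1) = leafy x.
Proof. by rewrite rt_degree_Some eqSS cards_eq0. Qed.

Definition rt_leaf (l : leaf rt_graph) : G :=
  if val l is Some x then odflt g [pick v in rt_set x] else g.

Let rt_leaf_Some (l : leaf rt_graph) x : val l = Some x ->
  leafy x /\ rt_set x = [set rt_leaf l].
Proof.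
move=> e; have lx : leafy x by rewrite -deg_leafy -e (valP l).
split=> //; case: (rt_children x) => [[_ [v ev]]|[]]; last by rewrite (eqP lx) cards0.
rewrite /rt_leaf e ev; case: pickP => [w|/(_ v)]; last by rewrite /= inE eqxx.
by rewrite /= inE => /eqP->.
Qed.

Let rt_leaf_None (l : leaf rt_graph) : (val l == None) = (rt_leaf l == g).
Proof.
case e: (val l) => [x|]; last by rewrite /rt_leaf e !eqxx.
have [_ sx] := rt_leaf_Some e; apply/esym/eqP=> lg.
by have := subsetP (rt_sub x) g; rewrite sx lg !inE eqxx => /(_ isT).
Qed.

(** Descend through the children whose label set contains [v]. The predicate [Q] is an invariant of
    the descent, later membership in a component. *)
Let walk_down (Q : pred N) (x : N) v : v \in rt_set x -> Q x ->
  (forall y z, Q y -> rt_par z = Some y -> v \in rt_set z -> Q z) ->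
  exists y, [/\ Q y, leafy y & rt_set y = [set v]].
Proof.
move=> vx Qx Qd; have x0 : (v \in rt_set x) && Q x by rewrite vx Qx.
have [y /andP[vy Qy] ymax] :=
  @arg_maxnP _ x (fun y => (v \in rt_set y) && Q y) (@rt_rank _ _ _ R) x0.
case: (rt_children y) => [[c0 [w ew]]|[c2 h]].
  exists y; split=> //; first by rewrite /leafy c0.
  by move: vy; rewrite ew inE => /eqP->.
have [z] := h _ vy; rewrite inE => /eqP pz vz.
have := ymax z; rewrite vz (Qd y z Qy pz vz) => /(_ isT) /=.
by rewrite leqNgt (rt_rank_lt pz).
Qed.

Let leaf_of (Q : pred N) (x : N) v : v \in rt_set x -> Q x ->
  (forall y z, Q y -> rt_par z = Some y -> v \in rt_set z -> Q z) ->
  exists l y, [/\ Q y, val l = Some y & rt_leaf l = v].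
Proof.
move=> vx Qx /(walk_down vx Qx)[y [Qy ly sy]].
have dy : degree (Some y : rt_graph) == 1 by rewrite deg_leafy.
exists (exist _ (Some y : rt_graph) dy), y; split=> //.
have [_] := @rt_leaf_Some (exist _ (Some y : rt_graph) dy) y erefl.
by rewrite sy => /set1_inj.
Qed.

Lemma rt_leaf_bij : bijective rt_leaf.
Proof.
have inj : injective rt_leaf.
  move=> l l' e; apply: val_inj.
  case el: (val l) => [x|]; last first.
    by move/eqP: el; rewrite rt_leaf_None e -rt_leaf_None => /eqP->.
  case el': (val l') => [x'|]; last first.
    by move/eqP: el'; rewrite rt_leaf_None -e -rt_leaf_None el.
  have [lx sx] := rt_leaf_Some el; have [lx' sx'] := rt_leaf_Some el'.
  congr Some; apply: rt_leaf_inj; [exact/eqP|exact/eqP|by rewrite sx sx' e].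
have sur v : exists l, rt_leaf l == v.
  have [->|vg] := eqVneq v g.
    have d : degree (None : rt_graph) == 1 by rewrite rt_degree_None.
    by exists (exist _ (None : rt_graph) d); rewrite -rt_leaf_None.
  have [r [_ sr]] := rt_root R.
  have vr : v \in rt_set r by rewrite sr !inE.
  have [//|l [y [_ _ e]]] := @leaf_of predT r v vr isT.
  by exists l; rewrite e.
exists (fun v => xchoose (sur v)) => [l|v].
  by apply: inj; apply/eqP; exact: (xchooseP (sur (rt_leaf l))).
exact/eqP/(xchooseP (sur v)).
Qed.

Definition rt_decomposition :=
  BranchDecomposition rt_is_tree rt_degree_ok rt_leaf_bij.

Let par_set2 (x : N) t u : par t u -> [set t; u] = [set Some x; rt_par x] -> t = Some x.
Proof.
move=> tu e; have [[]//|[e1 e2]] := @set2_eq_or rt_graph _ _ _ _ e.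
have px : par (Some x) (rt_par x) by rewrite /= eqxx.
by have := par_rank px; rewrite -e1 -e2 ltnNge (ltnW (par_rank tu)).
Qed.

(** Descending from [x] never leaves the component of [x]. For a label outside [rt_set x], the
    descent from the root never enters [x], so it stays in the component of the parent. *)
Lemma rt_side (x : N) :
  @bd_side _ rt_decomposition (Some x) (rt_par x) = rt_set x.
Proof.
have px : par (Some x) (rt_par x) by rewrite /= eqxx.
have ex := par_edge px; have nex := tree_bridge rt_is_tree ex.
have injl := bij_inj rt_leaf_bij.
apply: bd_side_eq => l /=.
apply/idP/idP => [vx|].
  pose Q y := (Some y : rt_graph) \in component (Some x : rt_graph) (rt_par x).
  have [||l' [y [Qy ey /injl el]]] := @leaf_of Q x _ vx; first exact: component_self.
    move=> y z Qy pz _; apply: (component_edge Qy).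
      by rewrite edge_sym par_edge //= pz.
    rewrite setUC; apply/negP=> /eqP/par_set2; rewrite /= pz eqxx => /(_ isT) [ezx].
    by rewrite ezx in pz; case/negP: nex; rewrite {1}pz.
  by rewrite -el ey.
apply: contraLR => vx; rewrite -in_setC (componentC rt_is_tree ex).
have xne := tree_bridge rt_is_tree (_ : edge (rt_par x : rt_graph) (Some x)).
rewrite edge_sym ex in xne; move/(_ isT): xne => xne.
set U := component _ _ in xne *.
have up t u : t \in U -> par t u -> u \in U.
  move=> tU tu; apply: (component_edge tU (par_edge tu)).
  rewrite [X in _ != X]setUC; apply/negP=> /eqP/(par_set2 tu) e.
  by move: xne; rewrite -e tU.
have NU : (None : rt_graph) \in U.
  have := component_self (rt_par x : rt_graph) (Some x); rewrite -/U.
  move: (rt_par x : rt_graph) => t; have [n] := ubnP (rank t); elim: n t => // n IHn [y|] //.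
  rewrite ltnS => le yU; have py : par (Some y) (rt_par y) by rewrite /= eqxx.
  by apply: (IHn (rt_par y)); [exact: leq_trans (par_rank py) le|exact: up yU py].
have [e|vg] := eqVneq (rt_leaf l) g.
  by have /eqP-> : val l == None by rewrite rt_leaf_None e.
have [r [hr sr]] := rt_root R.
have vr : rt_leaf l \in rt_set r by rewrite sr !inE.
pose Q y := (Some y : rt_graph) \in U.
have down y z : y \in U -> rt_par z = y -> rt_leaf l \in rt_set z -> Q z.
  move=> yU pz vz; apply: (component_edge yU).
    by rewrite edge_sym par_edge //= pz.
  rewrite setUC [X in _ != X]setUC; apply/negP=> /eqP/par_set2.
  by rewrite /= pz eqxx => /(_ isT) [ezx]; rewrite ezx (negPf vx) in vz.
have Qr : Q r by apply: down NU _ vr; apply/eqP; rewrite hr.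
have [|l' [y [Qy ey /injl el]]] := @leaf_of Q r _ vr Qr; last by rewrite -el ey.
by move=> y z Qy; apply: down.
Qed.

Lemma rt_width : bd_width rt_decomposition <= k.
Proof.
apply/bigmax_leqP=> -[t u] /=; rewrite /rt_edge => tu.
have main (x : N) : narrow k set0 (@bd_side _ rt_decomposition (Some x) (rt_par x)).
  by rewrite rt_side; apply: rt_prop.
suff [C [kC cC _]] : narrow k set0 (@bd_side _ rt_decomposition t u).
  exact: leq_trans (cover_matching cC) kC.
case/orP: tu.
  by case: t => [x|] //= /eqP<-.
case: u => [x|] //= /eqP<-.
rewrite (@bd_sideC _ rt_decomposition (Some x) (rt_par x)).
  exact: narrowC.
by apply: par_edge; rewrite /= eqxx.
Qed.

End TreeOfRtree.

Definition mmw_le2 (G : sgraph) := obuilt (@narrow G 2 set0) [set: G].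

(** The tree is rerooted at the leaf of some vertex [g]; as there is a second vertex, a nonempty
    tree hangs below it. *)
Lemma built_bd (G : sgraph) k : 1 < #|G| -> built (@narrow G k set0) [set: G] ->
  exists D : branch_decomposition G, bd_width D <= k.
Proof.
move=> G1 bG; have /card_gt0P[g _] := ltnW G1.
have /obuilt_neq0 bg : obuilt (@narrow G k set0) [set~ g].
  apply: built_reroot bG _ _; rewrite ?inE //; first exact: narrowC.
  by left; rewrite setCT.
have [|R] := built_rtree (bg _); last by exists (rt_decomposition R); exact: rt_width.
by rewrite -card_gt0 cardsC1; lia.
Qed.

Lemma bd_width_card (G : sgraph) (D : branch_decomposition G) : bd_width D <= #|G|.
Proof.
apply/bigmax_leqP=> p _; apply: leq_trans (cover_matching (cut_cover_id _)) _.
exact: max_card.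
Qed.

Lemma mmw_le (G : sgraph) (D : branch_decomposition G) k : bd_width D <= k -> mmw G <= k.
Proof.
move=> Dk; rewrite /mmw; case: pselect => [ex|no]; last by [].
case: ex_minnP => m _ /(_ (bd_width D)) h; apply: leq_trans Dk; apply: h.
by apply/asboolP; exists D.
Qed.

Lemma mmw_le2P (G : sgraph) : mmw G <= 2 <-> mmw_le2 G.
Proof.
have [G1|G1] := leqP #|G| 1.
  (* With at most one vertex both sides hold: the tree is empty or a single leaf, and the width is
     at most [#|G|] or the default 0. *)
  split=> _.
    have [e|n0] := eqVneq [set: G] set0; [by left|right].
    have /card_gt0P[x _] : 0 < #|[set: G]| by rewrite card_gt0.
    have -> : [set: G] = [set x].
      by apply/esym/eqP; rewrite eqEcard subsetT cards1 cardsT.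
    by apply: built1; apply: narrow_small; rewrite cards1.
  rewrite /mmw; case: pselect => [ex|no] //; case: ex_minnP => m /asboolP[D <-] _.
  by apply: leq_trans (bd_width_card D) (leqW G1).
have n0 : [set: G] != set0 by rewrite -card_gt0 cardsT ltnW.
split=> [mG|oG]; last by have [D] := built_bd G1 (obuilt_neq0 n0 oG); apply: mmw_le.
right; move: mG; rewrite /mmw; case: pselect => [ex|no].
  by case: ex_minnP => m /asboolP[D <-] _; apply: bd_built.
(* Some decomposition exists, because every cut is covered by all vertices of one side; hence the
   default value 0 of [mmw] does not arise. *)
have bT : built (@narrow G #|G| set0) [set: G].
  by apply: built_all => // B; apply/narrow_small/max_card.
case: no; have [D _] := built_bd G1 bT.
by exists (bd_width D); apply/asboolP; exists D.
Qed.

(** * Minors and extensions of a graph *)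

(* The vertices outside Rep carry no edge leaving their fibre, so each fibre  *)
(* can hang as a small subtree at the place of its image.                     *)
Lemma mmw_le2_blowup (F F' : sgraph) (f : F' -> F) (Rep : {set F'}) :
  {in Rep &, injective f} -> (forall v, #|f @^-1: [set v]| <= 3) ->
  (forall x y, x -- y -> f x != f y -> [/\ x \in Rep, y \in Rep & f x -- f y]) ->
  mmw_le2 F -> mmw_le2 F'.
Proof.
move=> injR le3 hE; rewrite /mmw_le2 -[[set: F']](_ : f @^-1: [set: F] = _); last first.
  by apply/setP=> x; rewrite !inE.
have cardR (C : {set F}) : #|Rep :&: f @^-1: C| <= #|C|.
  rewrite -(card_in_imset (f := f)); last first.
    by move=> x y; rewrite !inE => /andP[xR _] /andP[yR _]; apply: injR.
  by apply/subset_leq_card/subsetP=> _ /imsetP[x + ->]; rewrite !inE => /andP[].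
case=> [->|bF]; first by left; rewrite preimset0.
apply: (obuilt_preim bF) => [v _|B _ [C [kC /cut_coverP cC _]]].
  have [->|n0] := eqVneq (f @^-1: [set v]) set0; first by left.
  right; apply: built_sub (built_all (P := fun=> True) (fun=> I) n0) _ => B sB _.
  (* At most two vertices cover their own cut. The only other subset is a full fibre of three
     vertices, and its at most one vertex in [Rep] covers the cut. *)
  have [le2|gt2] := leqP #|B| 2; first exact: narrow_small.
  have -> : B = f @^-1: [set v].
    by apply/eqP; rewrite eqEcard sB (leq_trans (le3 v) gt2).
  exists (Rep :&: f @^-1: [set v]); split; last by rewrite set0I sub0set.
    by rewrite (leq_trans (cardR _)) ?cards1.
  apply/cut_coverP=> x y; rewrite !inE => xv yv xy.
  have [|-> _ _] := hE _ _ xy; last by rewrite xv.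
  by rewrite (eqP xv) eq_sym.
exists (Rep :&: f @^-1: C); split; last by rewrite set0I sub0set.
  exact: leq_trans (cardR _) kC.
apply/cut_coverP=> x y; rewrite !inE => xB yB xy.
have [|-> -> fxy] := hE _ _ xy; first by apply: contraTneq xB => ->.
exact: cC fxy.
Qed.

Lemma mmw_le2_hom (F F' : sgraph) (f : F' -> F) : injective f ->
  (forall x y, x -- y -> f x -- f y) -> mmw_le2 F -> mmw_le2 F'.
Proof.
move=> injf hE; apply: (@mmw_le2_blowup _ _ f [set: F']) => [x y _ _|v|x y xy _].
- exact: injf.
- apply: (@leq_trans #|[set v]|); last by rewrite cards1.
  rewrite -(card_imset _ injf).
  by apply/subset_leq_card/subsetP=> _ /imsetP[x + ->]; rewrite !inE.
- by rewrite !inE; split=> //; apply: hE.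
Qed.

Lemma mmw_le2_contract (F : sgraph) (u v : F) : u -- v ->
  mmw_le2 F -> mmw_le2 (contract u v).
Proof.
move=> uv; pose f (x : contract u v) : F := val x.
rewrite /mmw_le2 -[X in _ -> obuilt _ X](_ : f @^-1: [set: F] = _); last first.
  by apply/setP=> x; rewrite !inE.
case=> [->|bF]; first by left; rewrite preimset0.
apply: (obuilt_preim bF) => [w _|B _ [C [kC /cut_coverP cC _]]].
  have [->|n0] := eqVneq (f @^-1: [set w]) set0; first by left.
  right; apply: built_sub (built_all (P := fun=> True) (fun=> I) n0) _ => B sB _.
  apply: narrow_small; apply: leq_trans (subset_leq_card sB) _.
  apply: (@leq_trans #|[set w]|); last by rewrite cards1.
  rewrite -(card_imset _ val_inj).
  by apply/subset_leq_card/subsetP=> _ /imsetP[x + ->]; rewrite !inE.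
(* In the covers, [u] takes over the role of [v]. An edge inherited from [v] stands for a path of
   two edges through [v], one of which crosses the cut. *)
pose C' := [set x : contract u v | (f x \in C) || ((v \in C) && (f x == u))].
have fv (x : contract u v) : f x != v by have := valP x; rewrite !inE.
exists C'; split; last by rewrite set0I sub0set.
  apply: leq_trans kC; rewrite -(card_imset _ val_inj).
  have [vC|vC] := boolP (v \in C).
    rewrite (cardsD1 v C) vC; apply: leq_trans (_ : #|u |: C :\ v| <= _); last first.
      by rewrite cardsU1; case: (u \notin _).
    apply/subset_leq_card/subsetP=> _ /imsetP[x + ->]; rewrite !inE vC /= => /orP[xC|->//].
    by rewrite xC (fv x) orbT.
  apply/subset_leq_card/subsetP=> _ /imsetP[x + ->].
  by rewrite inE (negPf vC) /= orbF.
apply/cut_coverP=> x y; rewrite !inE => xB yB /= /andP[_].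
case/or3P=> [xy|/andP[/eqP xu vy]|/andP[/eqP yu vx]].
- by have /orP[->|->] := cC _ _ xB yB xy; rewrite ?orbT.
- have [vB|vB] := boolP (v \in B).
    by have /orP[->|->] := cC _ _ vB yB vy; rewrite ?orbT // /f xu eqxx orbT.
  have uv' : f x -- v by rewrite /f xu.
  by have /orP[->|->] := cC _ _ xB vB uv'; rewrite ?orbT // /f xu eqxx orbT.
- have [vB|vB] := boolP (v \in B).
    have vy : v -- f y by rewrite /f yu edge_sym.
    by have /orP[->|->] := cC _ _ vB yB vy; rewrite ?orbT // /f yu eqxx !orbT.
  have xv : f x -- v by rewrite edge_sym.
  by have /orP[->|->] := cC _ _ xB vB xv; rewrite ?orbT // /f yu eqxx !orbT.
Qed.

Lemma mmw_le2_step (F F' : sgraph) :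
  minor_step F F' -> mmw_le2 F -> mmw_le2 F'.
Proof.
case=> [v|u v uv|u v uv]; last exact: mmw_le2_contract.
  by apply: (@mmw_le2_hom F (del_vertices [set v]) (fun x => val x)) => //; exact: val_inj.
by apply: (@mmw_le2_hom _ (del_edge u v) (fun x : F => x)) => // x y /andP[].
Qed.

Lemma mmw_le2_minor (F F' : sgraph) :
  proper_minor F' F -> mmw_le2 F -> mmw_le2 F'.
Proof.
elim=> [G1 H|G1 K s _ IH] ; first exact: mmw_le2_step.
by move=> h; apply/IH/(mmw_le2_step s h).
Qed.

Definition step_minimal (F : sgraph) : Prop :=
  ~ mmw_le2 F /\ forall F', minor_step F F' -> mmw_le2 F'.

(** Width at most 2 passes to minors, so single steps decide minimality. *)
Lemma minor_minimal_mmw3P (F : sgraph) : minor_minimal_mmw3 F <-> step_minimal F.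
Proof.
split=> -[nF hF]; split.
- by move/mmw_le2P; rewrite leqNgt nF.
- by move=> F' sF'; apply/mmw_le2P/hF/ProperMinor1.
- by rewrite ltnNge; apply/negP=> /mmw_le2P.
- move=> F' pF'; apply/mmw_le2P; case: pF' => [s|K s pK]; first exact: hF.
  exact: mmw_le2_minor pK (hF _ s).
Qed.

(** * The walk from a to b in an extension of the graph *)

Section Core.
Variables (G0 : sgraph) (a b : G0).
Notation R := [set a; b].

Definition core : Prop :=
  exists A : {set G0}, built (narrow 2 R) A /\ built (narrow 2 R) (~: A).

(* The branching vertex of the tree at which the part of the tree controlled  *)
(* by a meets the part controlled by b.                                       *)
Definition tripod : Prop :=
  exists A B : {set G0}, [/\ a \in A, b \in B, [disjoint A & B],
    built (narrow 2 R) A & built (narrow 2 R) B /\ built (narrow 2 R) (~: (A :|: B))].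

End Core.

Lemma narrow_mincov (G : sgraph) k (R A : {set G}) :
  narrow k set0 A -> R :&: A \subset mincov A -> narrow k R A.
Proof.
by move=> nA RA; exists (mincov A); rewrite (mincov_narrow nA) mincov_cover.
Qed.

Section Extension.
Variables (G0 F : sgraph) (i : G0 -> F) (a b : G0).
Hypothesis inj_i : injective i.
Hypothesis edge_i : forall x y, x -- y -> i x -- i y.

Notation R0 := [set a; b].
Notation RF := [set i a; i b].

Definition new_vertices : {set F} := ~: [set i x | x in G0].
Notation X := new_vertices.

Hypothesis link_a : exists2 x, x \in X & i a -- x.
Hypothesis link_b : exists2 x, x \in X & i b -- x.
(** This holds as soon as some path from [a] to [b] has inner vertices, all of them new: one of its
    edges crosses the cut. *)
Hypothesis link_ab : forall A C, cut_cover A C -> i a \notin A -> i b \in A ->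
  i a \notin C -> i b \notin C -> exists2 x, x \in C & x \in X.

Lemma cut_cover_pull A C : cut_cover A C -> cut_cover (i @^-1: A) (i @^-1: C).
Proof.
move/cut_coverP=> h; apply/cut_coverP=> x y; rewrite !inE => xA yA /edge_i.
exact: h.
Qed.

Lemma card_pull (C : {set F}) : #|i @^-1: C| <= #|C|.
Proof.
rewrite -(card_imset _ inj_i); apply/subset_leq_card/subsetP.
by move=> _ /imsetP[x + ->]; rewrite inE.
Qed.

Lemma card_pull_lt (C : {set F}) x : x \in C -> x \in X -> #|i @^-1: C| < #|C|.
Proof.
move=> xC xX; rewrite -(card_imset _ inj_i); apply/proper_card/properP; split.
  by apply/subsetP=> _ /imsetP[y + ->]; rewrite inE.
exists x => //; apply: contraTN xX => /imsetP[y _ ->].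
by rewrite !inE negbK imset_f.
Qed.

Lemma built_pull1 v : obuilt (narrow 2 R0) (i @^-1: [set v]).
Proof.
have [->|n0] := eqVneq (i @^-1: [set v]) set0; first by left.
right; apply: built_sub (built_all (P := fun=> True) (fun=> I) n0) _ => B sB _.
apply: narrow_small; apply: leq_trans (subset_leq_card sB) (leq_trans (card_pull _) _).
by rewrite cards1.
Qed.

Lemma built_pull A : built (narrow 2 RF) A -> obuilt (narrow 2 R0) (i @^-1: A).
Proof.
move=> bA; apply: (obuilt_preim bA) => [v _|B _ [C [kC cC RC]]].
  exact: built_pull1.
exists (i @^-1: C); rewrite cut_cover_pull // (leq_trans (card_pull _) kC); split=> //.
apply/subsetP=> x; rewrite !inE => /andP[xab xB]; apply: (subsetP RC).
by rewrite !inE xB andbT; case/orP: xab => /eqP->; rewrite eqxx ?orbT.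
Qed.

(** Adding [b] to a pulled-back cover costs nothing: either [b] is already there, or a new vertex of
    the cover is lost in the pull-back. *)
Lemma built_pull_below A : built (narrow 2 set0) A -> i a \notin A ->
  (forall B : {set F}, B \subset A -> i b \in B ->
     i b \in mincov B \/ exists2 x, x \in mincov B & x \in X) ->
  obuilt (narrow 2 R0) (i @^-1: A).
Proof.
move=> bA aA hb; apply: (obuilt_preim bA) => [v _|B sB nB].
  exact: built_pull1.
have aB : i a \notin B by apply: contra aA; apply: (subsetP sB).
have kB := mincov_narrow nB; have cB := cut_cover_pull (mincov_cover B).
have [bB|bB] := boolP (i b \in B); last first.
  exists (i @^-1: mincov B); rewrite cB (leq_trans (card_pull _) kB); split=> //.
  apply/subsetP=> x; rewrite !inE => /andP[/orP[]/eqP->]; first by rewrite (negPf aB).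
  by rewrite (negPf bB).
exists (b |: i @^-1: mincov B); split; last 1 first.
- apply/subsetP=> x; rewrite !inE => /andP[/orP[]/eqP->]; first by rewrite (negPf aB).
  by rewrite eqxx.
- rewrite cardsU1 inE; have [bC|[x xC xX]] := hb B sB bB.
    by rewrite bC (leq_trans (card_pull _) kB).
  apply: leq_trans kB; apply: leq_trans (card_pull_lt xC xX).
  by rewrite -add1n leq_add2r; case: (_ \notin _).
- exact: cut_cover_super (subsetUr _ _) cB.
Qed.

(** Since [a] is not in [mincov A], [mincov_outer] keeps it out of every [mincov B] below. Where [b]
    is missing too, [link_ab] supplies a new vertex to trade for [b]. *)
Lemma gap_core A : built (narrow 2 set0) A -> i a \notin A -> i b \in A ->
  i a \notin mincov A -> i b \notin mincov A ->
  built (narrow 2 R0) (i @^-1: (~: A)) -> core a b.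
Proof.
move=> bA aA bAb aC bC bcA; exists (i @^-1: A); split; last by rewrite -preimsetC.
apply: obuilt_neq0; first by apply/set0Pn; exists b; rewrite inE.
apply: built_pull_below => // B sB bB.
have [bCB|bCB] := boolP (i b \in mincov B); [by left|right].
apply: link_ab (mincov_cover B) _ bB _ bCB.
  by apply: contra aA; apply: (subsetP sB).
apply: contra aC => aCB; apply: (subsetP (mincov_outer sB)).
by rewrite inE aA.
Qed.

(** The invariant of the walk is that the current cover contains [a] but not [b]. At the child [B]
    containing [b], a cover with [b] makes the branching vertex a tripod, a cover with [a] only
    continues the walk, and a cover with neither is settled by [gap_core]. *)
Lemma descend A : built (narrow 2 set0) A -> i a \notin A -> i b \in A ->
  i a \in mincov A -> i b \notin mincov A -> built (narrow 2 RF) (~: A) ->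
  core a b \/ tripod (i a) (i b).
Proof.
elim=> [v _|A1 A2 b1 IH1 b2 IH2 dA nA].
  (* The walk cannot reach the leaf [b]: a minimum cover there has at most one vertex, but would
     contain both [a] and a new neighbour of [b]. *)
  rewrite !inE => _ /eqP <- aC bC _; have [x xX bx] := link_b.
  have /cut_coverP/(_ (i b) x) := mincov_cover [set i b].
  rewrite !inE eqxx bx (negPf bC) /= => xC.
  have xb : x != i b by apply: contraTneq xX => ->; rewrite inE negbK imset_f.
  have := mincov_min (cut_cover_id [set i b]); rewrite cards1.
  have xa : x != i a by apply: contraTneq xX => ->; rewrite inE negbK imset_f.
  have sub : [set x; i a] \subset mincov [set i b].
    by apply/subsetP=> y; rewrite !inE => /orP[]/eqP-> //; apply: xC.
  by move: (subset_leq_card sub); rewrite cards2 xa; lia.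
have step B S : built (narrow 2 set0) B -> built (narrow 2 set0) S ->
    [disjoint B & S] ->
    (i a \notin B -> i b \in B -> i a \in mincov B -> i b \notin mincov B ->
      built (narrow 2 RF) (~: B) -> core a b \/ tripod (i a) (i b)) ->
    i a \notin B :|: S -> i b \in B -> built (narrow 2 RF) (~: (B :|: S)) ->
    core a b \/ tripod (i a) (i b).
  move=> bB bS dBS IH; rewrite in_setU negb_or => /andP[aB aS] bBb bc.
  have bS' : i b \notin S by rewrite (disjointFr dBS bBb).
  have nfree (E : {set F}) : E \subset S -> narrow 2 set0 E -> narrow 2 RF E.
    move=> ES; apply: narrow_free; rewrite disjoints_subset; apply/subsetP=> y.
    rewrite !inE => /orP[]/eqP->; first by apply: contra aS; apply: (subsetP ES).
    by apply: contra bS'; apply: (subsetP ES).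
  have gS : built (narrow 2 RF) S by apply: built_sub bS nfree.
  have cBS : ~: B = ~: (B :|: S) :|: S.
    apply/setP=> y; rewrite !inE; have := disjointFr dBS (x := y).
    by case: (y \in B) => [/(_ isT)->|_]; case: (y \in S).
  have dcS : [disjoint ~: (B :|: S) & S].
    rewrite disjoint_sym disjoints_subset setCK; exact: subsetUr.
  have [bC|bC] := boolP (i b \in mincov B).
    right; exists (~: (B :|: S)), B; split.
    - by rewrite !inE negb_or aB.
    - by [].
    - by rewrite disjoint_sym disjoints_subset setCK subsetUl.
    - by [].
    split; last first.
      suff -> : ~: (~: (B :|: S) :|: B) = S by [].
      apply/setP=> y; rewrite !inE; have := disjointFr dBS (x := y).
      by case: (y \in B) => [/(_ isT)->|_]; case: (y \in S).
    (* By [mincov_inner], [b] stays in the covers of all subtrees that contain it. *)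
    apply: built_sub bB _ => E EB nE; apply: narrow_mincov => //.
    apply/subsetP=> y; rewrite !inE => /andP[/orP[]/eqP-> yE].
      by rewrite (subsetP EB _ yE) in aB.
    by apply: (subsetP (mincov_inner EB)); rewrite inE bC.
  have kB := mincov_narrow (built_prop bB).
  have [aC|aC] := boolP (i a \in mincov B).
    apply: IH => //; rewrite cBS; apply: builtU => //; rewrite -cBS.
    exists (mincov B); split=> //; first exact/cut_coverC/mincov_cover.
    apply/subsetP=> y; rewrite !inE => /andP[/orP[]/eqP-> //].
    by rewrite bBb.
  left; apply: (gap_core bB) => //.
  have /cut_coverP cB := mincov_cover B.
  have [x xC xX] := link_ab (mincov_cover B) aB bBb aC bC.
  apply: obuilt_neq0; first by apply/set0Pn; exists a; rewrite !inE.
  rewrite cBS preimsetU; apply: obuiltU; try exact: built_pull.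
    rewrite -setI_eq0 -preimsetI; move: dcS; rewrite -setI_eq0 => /eqP->.
    by rewrite preimset0.
  (* Seen from the upper side, the new vertex [x] is traded for [a]. *)
  rewrite -preimsetU -cBS; exists (a |: i @^-1: mincov B); split.
  - apply: leq_trans kB; apply: leq_trans (card_pull_lt xC xX).
    by rewrite cardsU1 -add1n leq_add2r; case: (_ \notin _).
  - apply: cut_cover_super (subsetUr _ _) (cut_cover_pull _).
    exact/cut_coverC/mincov_cover.
  - apply/subsetP=> y; rewrite !inE => /andP[/orP[]/eqP->]; first by rewrite eqxx.
    by rewrite bBb.
move=> aA; rewrite inE => /orP[bA|bA] _ _ bc.
  exact: step b1 b2 dA IH1 aA bA bc.
rewrite setUC in aA bc; rewrite disjoint_sym in dA.
exact: step b2 b1 dA IH2 aA bA bc.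
Qed.

Lemma extension_core : a != b -> mmw_le2 F -> core a b \/ tripod (i a) (i b).
Proof.
move=> ab; have iab : i a != i b by rewrite (inj_eq inj_i).
case=> [e|bF]; first by have := in_setT (i a); rewrite e inE.
have bA : built (narrow 2 set0) [set~ i a].
  apply: obuilt_neq0; first by apply/set0Pn; exists (i b); rewrite !inE eq_sym.
  apply: built_reroot bF _ _; rewrite ?inE //; first exact: narrowC.
  by left; rewrite setCT.
have b1 S : built (@narrow F 2 S) [set i a].
  by apply/built1/narrow_small; rewrite cards1.
have ma : #|mincov [set~ i a]| <= 1.
  by rewrite -(cards1 (i a)); apply/mincov_min/cut_coverC/cut_cover_id.
have aA : i a \notin [set~ i a] by rewrite !inE eqxx.
have bA' : i b \in [set~ i a] by rewrite !inE eq_sym.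
(* The minimum cover at the leaf [a] has at most one vertex, and the edge from [a] to a new vertex
   forces it to be an end of that edge. *)
have bC : i b \notin mincov [set~ i a].
  apply/negP=> bC; have [x xX ax] := link_a.
  have nX z : x != i z by apply: contraTneq xX => ->; rewrite inE negbK imset_f.
  have /cut_coverP/(_ x (i a)) := mincov_cover [set~ i a].
  rewrite !inE eqxx nX edge_sym ax => /(_ isT isT isT) h.
  have [y yC yb] : exists2 y, y \in mincov [set~ i a] & i b != y.
    by case/orP: h => h; [exists x|exists (i a)]; rewrite // eq_sym.
  have s : [set i b; y] \subset mincov [set~ i a].
    by apply/subsetP=> z; rewrite !inE => /orP[]/eqP->.
  by move: (subset_leq_card s) ma; rewrite cards2 yb; lia.
have [aC|aC] := boolP (i a \in mincov [set~ i a]).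
  by apply: (descend bA) => //; rewrite setCK.
left; apply: (gap_core bA) => //; rewrite setCK.
apply: obuilt_neq0 (built_pull (b1 _)).
by apply/set0Pn; exists a; rewrite !inE.
Qed.

End Extension.

(** * Attaching two new vertices at a and b *)

Lemma built_imset (V W : finType) (f : V -> W) (P : {set V} -> Prop)
    (Q : {set W} -> Prop) (A : {set V}) :
  injective f -> (forall B : {set V}, P B -> Q (f @: B)) -> built P A -> built Q (f @: A).
Proof.
move=> injf PQ; elim=> [v Pv|A1 B _ bA _ bB dAB PAB].
  by have := PQ _ Pv; rewrite imset_set1; apply: built1.
have := PQ _ PAB; rewrite imsetU; apply: builtU => //.
rewrite disjoints_subset; apply/subsetP=> _ /imsetP[x xA ->]; rewrite inE.
by rewrite mem_imset // (disjointFr dAB xA).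
Qed.

(* Two new vertices are attached to a and b: by the paths a-c'-b and a-d'-b   *)
(* when twin holds, by the path a-c-d-b otherwise.                            *)
Section Attach.
Variables (twin : bool) (G0 : sgraph) (a b : G0).

Definition attached (s : bool) (x : G0) : bool :=
  if twin then (x == a) || (x == b) else x == (if s then a else b).

Definition attach_rel : rel (G0 + bool) := fun x y => match x, y with
  | inl u, inl v => u -- v
  | inl u, inr s => attached s u
  | inr s, inl v => attached s v
  | inr s, inr t => ~~ twin && (s != t)
  end.
Fact attach_sym : symmetric attach_rel.
Proof. by case=> [u|s] [v|t] //=; rewrite ?(edge_sym u) // eq_sym. Qed.
Fact attach_irr : irreflexive attach_rel.
Proof. by case=> [u|s] //=; rewrite ?edge_irr // eqxx andbF. Qed.
Definition attach := SGraph attach_sym attach_irr.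

Lemma attached_ends s x : attached s x -> (x == a) || (x == b).
Proof. by rewrite /attached; case: twin s => -[] // ->; rewrite ?orbT. Qed.

(** The covers contain [a] and [b] whenever these lie below, so they also cover the edges to the new
    vertices. The pair of new vertices is hung as a subtree on the joining edge; joined with the
    tree over [A], it has the same cut as the other tree. *)
Lemma core_attach : core a b -> mmw_le2 attach.
Proof.
pose i (x : G0) : attach := inl x.
have inj_i : injective i by move=> x y [].
have push (B : {set G0}) : narrow 2 [set a; b] B -> narrow 2 set0 (i @: B).
  case=> C [kC /cut_coverP cC RC]; exists (i @: C).
  rewrite card_imset // set0I sub0set; split=> //.
  apply/cut_coverP=> _ y /imsetP[x xB ->].
  case: y => [y|s]; first by rewrite !mem_imset // => yB; apply: cC.
  move=> _ /= /attached_ends ab; rewrite mem_imset //.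
  by rewrite (subsetP RC) // !inE ab xB.
case=> A [bA bA']; right.
have gA := built_imset inj_i push bA; have gA' := built_imset inj_i push bA'.
have b2 : built (@narrow attach 2 set0) [set inr true; inr false].
  apply: builtU; try by apply/built1/narrow_small; rewrite cards1.
    by rewrite disjoints_subset; apply/subsetP=> x; rewrite !inE => /eqP->.
  by apply: narrow_small; rewrite cards2.
have eA : i @: A :|: [set inr true; inr false] = ~: (i @: (~: A)).
  apply/setP=> -[x|s].
    rewrite in_setC in_setU -![inl x]/(i x) !mem_imset // !inE negbK.
    by rewrite orbF.
  rewrite in_setC in_setU.
  have no B : (inr s \in i @: B) = false by apply/negP=> /imsetP[].
  by rewrite !no !inE; case: s {no}.
have eT : (i @: A :|: [set inr true; inr false]) :|: i @: (~: A) = [set: attach].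
  by rewrite eA setUC setUCr.
rewrite -eT; apply: builtU => //.
- apply: builtU => //; last by rewrite eA; exact: narrowC (built_prop gA').
  rewrite disjoints_subset; apply/subsetP=> _ /imsetP[x _ ->].
  by rewrite !inE.
- by rewrite eA disjoint_sym disjoints_subset setCK.
- exists set0; rewrite cards0 set0I subxx; split=> //.
  by apply/cut_coverP=> x y _; rewrite eT inE.
Qed.

Hypothesis ab : a != b.

Let i (x : G0) : attach := inl x.
Let inj_i : injective i. Proof. by move=> x y []. Qed.

Let new_vertex (s : bool) : (inr s : attach) \in new_vertices i.
Proof. by rewrite inE; apply/negP=> /imsetP[]. Qed.

Let edge_a : edge (inl a : attach) (inr true).
Proof. by rewrite /= /attached; case: twin; rewrite eqxx. Qed.
Let edge_b : edge (inl b : attach) (inr false).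
Proof. by rewrite /= /attached; case: twin; rewrite eqxx ?orbT. Qed.

(* Every cut separating a from b separates two consecutive vertices of some   *)
(* path from a to b through the new vertices.                                 *)
Let cross_path (A C : {set attach}) : cut_cover A C ->
  inl a \notin A -> inl b \in A -> inl a \notin C -> inl b \notin C ->
  exists s, (inr s : attach) \in C.
Proof.
move=> /cut_coverP cC aA bA aC bC.
have [cA|cA] := boolP ((inr true : attach) \in A).
  exists true; have := cC _ _ cA aA; rewrite edge_sym edge_a (negPf aC) orbF.
  exact.
have [tw|tw] := boolP twin.
  exists true; have := cC _ _ bA cA; rewrite /= /attached tw eqxx orbT (negPf bC).
  exact.
have [dA|dA] := boolP ((inr false : attach) \in A).
  have := cC _ _ dA cA; rewrite /= tw => /(_ isT) /orP[]; by [exists false|exists true].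
exists false; have := cC _ _ bA dA; rewrite edge_b (negPf bC).
exact.
Qed.

(** It remains to treat a tripod. If the cover of one branch has no old vertex besides [a] and [b],
    the tree can be split at that branch ([thin], [swap]). Otherwise the size bound on the three
    covers is violated. *)
Lemma attach_core : mmw_le2 attach -> core a b.
Proof.
move=> oF.
have [||||//|] := @extension_core G0 attach i a b inj_i _ _ _ _ ab oF.
- by [].
- by exists (inr true).
- by exists (inr false).
- move=> A C cC aA bA aC bC; have [s sC] := cross_path cC aA bA aC bC.
  by exists (inr s).
case=> A [B [aA bB dAB bA [bB' bD]]].
have := built_pull inj_i (_ : forall x y, x -- y -> i x -- i y) bA.
move=> /(_ (fun _ _ h => h)) /obuilt_neq0 pA.
have := built_pull inj_i (_ : forall x y, x -- y -> i x -- i y) bB'.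
move=> /(_ (fun _ _ h => h)) /obuilt_neq0 pB.
have := built_pull inj_i (_ : forall x y, x -- y -> i x -- i y) bD.
move=> /(_ (fun _ _ h => h)) pD.
have {}pA : built (narrow 2 [set a; b]) (i @^-1: A).
  by apply: pA; apply/set0Pn; exists a; rewrite inE.
have {}pB : built (narrow 2 [set a; b]) (i @^-1: B).
  by apply: pB; apply/set0Pn; exists b; rewrite inE.
have dI : [disjoint i @^-1: A & i @^-1: B].
  rewrite -setI_eq0 -preimsetI; move: dAB; rewrite -setI_eq0 => /eqP->.
  by rewrite preimset0.
have [CA [kA cA RA]] := built_prop bA.
have [CB [kB cB RB]] := built_prop bB'.
have [CD [kD cD _]] := built_prop bD.
(* If [a] and [b] are the only old vertices of a cover, the pair covers the cut and is admissible
   from both sides. *)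
have thin (E C : {set attach}) : cut_cover E C -> i @^-1: C \subset [set a; b] ->
    narrow 2 [set a; b] (i @^-1: E) /\ narrow 2 [set a; b] (~: (i @^-1: E)).
  move=> cE sC; have cE' : cut_cover (i @^-1: E) [set a; b].
    by apply: cut_cover_super sC _; apply: cut_cover_pull.
  by split; exists [set a; b]; rewrite cards2 ?subsetIl ?cut_coverC ?cE' ?ab.
have swap (P Q : {set G0}) : [disjoint P & Q] -> built (narrow 2 [set a; b]) P ->
    built (narrow 2 [set a; b]) Q -> obuilt (narrow 2 [set a; b]) (~: (P :|: Q)) ->
    narrow 2 [set a; b] (~: P) -> core a b.
  move=> dPQ bP bQ oPQ nP; exists P; split=> //.
  have e : ~: P = Q :|: ~: (P :|: Q).
    apply/setP=> x; rewrite !inE; have := disjointFr dPQ (x := x).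
    by case: (x \in P) => [/(_ isT)->|_]; case: (x \in Q).
  rewrite e; apply: obuilt_neq0.
    by have /set0Pn[x xQ] := built_neq0 bQ; apply/set0Pn; exists x; rewrite inE xQ.
  apply: obuiltU oPQ _ _; [by right| |by rewrite -e].
  by rewrite disjoints_subset setCK subsetUr.
rewrite preimsetC preimsetU in pD.
have [sA|/subsetPn[x]] := boolP (i @^-1: CA \subset [set a; b]).
  exact: swap dI pA pB pD (proj2 (thin _ _ cA sA)).
rewrite inE => xA xab.
have [sB|/subsetPn[y]] := boolP (i @^-1: CB \subset [set a; b]).
  rewrite disjoint_sym in dI; rewrite (setUC (i @^-1: A)) in pD.
  exact: swap dI pB pA pD (proj2 (thin _ _ cB sB)).
rewrite inE => yB yab.
have [sD|/subsetPn[z]] := boolP (i @^-1: CD \subset [set a; b]).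
  have nD := thin _ _ cD sD; rewrite preimsetC preimsetU setCK in nD.
  have bAB : built (narrow 2 [set a; b]) (i @^-1: A :|: i @^-1: B).
    by apply: builtU => //; case: nD.
  case: pD => [e|bD']; last by exists (i @^-1: A :|: i @^-1: B).
  exists (i @^-1: A); split=> //; suff -> : ~: (i @^-1: A) = i @^-1: B by [].
  apply/setP=> w; move/setP/(_ w): e; rewrite !inE; have := disjointFr dAB (x := i w).
  by case: (i w \in A) => [/(_ isT)->|_]; case: (i w \in B).
rewrite inE => zD zab.
have only (C : {set attach}) p q r : #|C| <= 2 -> p \in C -> q \in C -> r \in C -> p != q ->
    (r == p) || (r == q :> attach).
  move=> kC pC qC rC pq; apply: contraLR kC; rewrite negb_or -ltnNge => /andP[rp rq].
  have s : [set p; q; r] \subset C by apply/subsetP=> w; rewrite !inE -orbA => /or3P[]/eqP->.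
  apply: leq_trans (subset_leq_card s); rewrite setUC cardsU1 cards2 !inE negb_or.
  by rewrite rp rq pq.
(* The first two covers are now exactly [a], [x] and [b], [y]. They contain no new vertex, which
   forces both new vertices into the third branch. *)
have aCA : i a \in CA by apply: (subsetP RA); rewrite !inE eqxx aA.
have bCB : i b \in CB by apply: (subsetP RB); rewrite !inE eqxx orbT bB.
have [xa xb] : x != a /\ x != b by move: xab; rewrite !inE negb_or => /andP[].
have [ya yb] : y != a /\ y != b by move: yab; rewrite !inE negb_or => /andP[].
have [za zb] : z != a /\ z != b by move: zab; rewrite !inE negb_or => /andP[].
have onlyA w : w \in CA -> (w == i a) || (w == i x).
  by move=> wC; apply: only kA aCA xA wC _; rewrite (inj_eq inj_i) eq_sym.
have onlyB w : w \in CB -> (w == i b) || (w == i y).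
  by move=> wC; apply: only kB bCB yB wC _; rewrite (inj_eq inj_i) eq_sym.
have bnA : i b \notin A by rewrite (disjointFl dAB bB).
have anB : i a \notin B by rewrite (disjointFr dAB aA).
have nA s : (inr s : attach) \notin CA by apply/negP=> /onlyA.
have nB s : (inr s : attach) \notin CB by apply/negP=> /onlyB.
have nbA : i b \notin CA.
  by apply/negP=> /onlyA; rewrite !(inj_eq inj_i) ![b == _]eq_sym (negPf ab) (negPf xb).
have naB : i a \notin CB.
  by apply/negP=> /onlyB; rewrite !(inj_eq inj_i) (negPf ab) eq_sym (negPf ya).
move/cut_coverP: cA => cA; move/cut_coverP: cB => cB.
have offA s : edge (i b) (inr s) -> (inr s : attach) \notin A.
  move=> bs; apply/negP=> sA; have := cA _ _ sA bnA.
  by rewrite edge_sym bs (negPf (nA s)) (negPf nbA) => /(_ isT).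
have offB s : edge (i a) (inr s) -> (inr s : attach) \notin B.
  move=> bs; apply/negP=> sB; have := cB _ _ sB anB.
  by rewrite edge_sym bs (negPf (nB s)) (negPf naB) => /(_ isT).
have fA : (inr false : attach) \notin A := offA _ edge_b.
have tB : (inr true : attach) \notin B := offB _ edge_a.
have tA : (inr true : attach) \notin A.
  have [tw|tw] := boolP twin; first by apply: offA; rewrite /= /attached tw eqxx orbT.
  apply/negP=> h; have := cA _ _ h fA.
  by rewrite (negPf (nA _)) (negPf (nA _)) /= tw => /(_ isT).
have fB : (inr false : attach) \notin B.
  have [tw|tw] := boolP twin; first by apply: offB; rewrite /= /attached tw eqxx.
  apply/negP=> h; have := cB _ _ h tB.
  by rewrite (negPf (nB _)) (negPf (nB _)) /= tw => /(_ isT).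
move/cut_coverC: cD; rewrite setCK => /cut_coverP cD.
(* The edge from [a] to [inr true] and the edge from [b] to [inr false] both leave the third branch.
   Covering them takes two vertices besides [z]. *)
have h1 : (i a \in CD) || ((inr true : attach) \in CD).
  by apply: cD edge_a; rewrite !inE ?negb_or ?aA ?tA.
have h2 : (i b \in CD) || ((inr false : attach) \in CD).
  by apply: cD edge_b; rewrite !inE ?negb_or ?bB ?orbT ?fA.
have [p pC pE] : exists2 p, p \in CD & (p == i a) || (p == inr true).
  by case/orP: h1 => h; [exists (i a)|exists (inr true)]; rewrite ?eqxx ?orbT.
have [q qC qE] : exists2 q, q \in CD & (q == i b) || (q == inr false).
  by case/orP: h2 => h; [exists (i b)|exists (inr false)]; rewrite ?eqxx ?orbT.
have ne : p != q.
  by case/orP: pE => /eqP->; case/orP: qE => /eqP->; rewrite // (inj_eq inj_i).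
have := only _ _ _ _ kD pC qC zD ne.
by case/orP: pE => /eqP->; case/orP: qE => /eqP->;
  rewrite ?(inj_eq inj_i) ?(negPf za) ?(negPf zb).
Qed.

End Attach.

(** * Single minor operations *)

Section Bypass.
Variables (chord : bool) (G0 : sgraph) (a b : G0).

(** [None] is the middle vertex of a path from [a] to [b], and [chord] adds the edge [ab]. Steps
    that touch a new vertex lead to subgraphs of these graphs, up to pendant pieces. *)
Definition bypass_rel : rel (option G0) := fun x y => match x, y with
  | Some u, Some v => u -- v || [&& chord, u != v, u \in [set a; b] & v \in [set a; b]]
  | Some u, None => u \in [set a; b]
  | None, Some v => v \in [set a; b]
  | None, None => false
  end.
Fact bypass_sym : symmetric bypass_rel.
Proof.
by case=> [u|] [v|] //=; rewrite edge_sym eq_sym [(u \in _) && _]andbC.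
Qed.
Fact bypass_irr : irreflexive bypass_rel.
Proof. by case=> [u|] //=; rewrite edge_irr eqxx andbF. Qed.
Definition bypass := SGraph bypass_sym bypass_irr.

End Bypass.

(** With [core] excluded, [extension_core] yields a tripod. Its covers contain [a] and [b] whenever
    these lie below, so they also cover the chord, and its three trees join to a tree for the larger
    graph. *)
Lemma bypass_chord (G0 : sgraph) (a b : G0) : a != b -> ~ core a b ->
  mmw_le2 (bypass false a b) -> mmw_le2 (bypass true a b).
Proof.
move=> ab nc oK; pose K := bypass false a b; pose L := bypass true a b.
pose i (x : G0) : K := Some x.
have inj_i : injective i by move=> x y [].
have newN : (None : K) \in new_vertices i by rewrite inE; apply/negP=> /imsetP[].
have [||||//|] := @extension_core G0 K i a b inj_i _ _ _ _ ab oK.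
- by move=> x y xy; rewrite /= xy.
- by exists None; rewrite //= !inE eqxx.
- by exists None; rewrite //= !inE eqxx orbT.
- move=> A C /cut_coverP cC aA bA aC bC; exists None => //.
  have [NA|NA] := boolP ((None : K) \in A).
    by have := cC _ _ NA aA; rewrite /= !inE eqxx (negPf aC) orbF; apply.
  by have := cC _ _ bA NA; rewrite /= !inE eqxx orbT (negPf bC); apply.
case=> A [B [aA bB dAB bA [bB' bD]]].
have KL (E : {set K}) : narrow 2 [set i a; i b] E -> narrow 2 set0 (E : {set L}).
  case=> C [kC /cut_coverP cC RC]; exists C; rewrite set0I sub0set; split=> //.
  apply/cut_coverP=> x y xE yE.
  have [xy|nxy] := boolP (edge (x : K) y); first by move=> _; apply: cC.
  case: x y xE yE nxy => [u|] [v|] //= uE vE; rewrite ?orbF; last by move/negP.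
    move=> /negPf-> /= /and3P[_ + _]; rewrite !inE => uab.
    apply/orP; left; apply: (subsetP RC); rewrite !inE uE andbT.
    by case/orP: uab => /eqP->; rewrite eqxx ?orbT.
  by move/negP.
have gA := built_sub bA (fun E _ => @KL E).
have gB := built_sub bB' (fun E _ => @KL E).
have gD := built_sub bD (fun E _ => @KL E).
have eT : (A :|: B) :|: ~: (A :|: B) = [set: L] by rewrite setUCr.
right; rewrite -eT; apply: builtU => //.
- apply: builtU => //; rewrite -[A :|: B]setCK.
  exact: (@narrowC L _ _ (built_prop gD)).
- by rewrite disjoints_subset setCK.
- exists set0; rewrite cards0 set0I subxx; split=> //.
  by apply/cut_coverP=> x y _; rewrite eT inE.
Qed.

(** A step of [F'] is matched with the step of [F] at the image, whose result still contains that of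
    [F']. *)
Lemma steps_hom (F F' : sgraph) (g : F' -> F) : injective g ->
  (forall x y, x -- y -> g x -- g y) ->
  (forall F1, minor_step F F1 -> mmw_le2 F1) ->
  forall F1, minor_step F' F1 -> mmw_le2 F1.
Proof.
move=> injg hg hF F1 s1.
have sub v (x : {x : F' | x \in ~: [set v]}) : g (val x) \in ~: [set g v].
  by have := valP x; rewrite !inE (inj_eq injg).
case: s1 => [v|u v uv|u v uv].
- apply: (mmw_le2_hom (f := fun x : del_vertices [set v] =>
    (exist _ (g (val x)) (sub v x) : del_vertices [set g v]))).
  + by move=> x y [] /injg/val_inj.
  + by move=> x y /hg.
  + exact/hF/StepDelVertex.
- apply: (@mmw_le2_hom (del_edge (g u) (g v)) (del_edge u v) g) => //.
    move=> x y /andP[/hg xy ne]; rewrite /= /del_edge_rel /= xy /=.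
    by apply: contra_neq ne => e; apply: (imset_inj injg); rewrite !imsetU !imset_set1.
  exact/hF/StepDelEdge/hg.
- apply: (mmw_le2_hom (f := fun x : contract u v =>
    (exist _ (g (val x)) (sub v x) : contract (g u) (g v)))).
  + by move=> x y [] /injg/val_inj.
  + move=> x y /= /andP[ne h]; apply/andP; split.
      by apply: contra_neq ne => -[] /injg/val_inj.
    rewrite /= !(inj_eq injg).
    by case/or3P: h => [/hg->|/andP[-> /hg->]|/andP[-> /hg->]]; rewrite ?orbT.
  + exact/hF/StepContract/hg.
Qed.

Lemma step_minimal_hom (F F' : sgraph) (h : F -> F') (g : F' -> F) :
  injective h -> (forall x y, x -- y -> h x -- h y) ->
  injective g -> (forall x y, x -- y -> g x -- g y) ->
  step_minimal F -> step_minimal F'.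
Proof.
move=> ih hh ig hg [nF sF]; split; last exact: (steps_hom ig hg sF).
by move=> oF'; apply: nF; exact: (mmw_le2_hom ih hh oF').
Qed.

(** A fibre holds at most one old vertex besides the two new ones. *)
Lemma card_fibre3 (G0 T : finType) (f : G0 + bool -> T) v :
  injective (f \o inl) -> #|f @^-1: [set v]| <= 3.
Proof.
move=> injf.
have le3 (x y z : G0 + bool) : #|[set x; y; z]| <= 3.
  rewrite setUC cardsU1 cards2; case: (_ \notin _); case: (_ != _) => //.
have [/existsP[y /eqP fy]|no] := boolP [exists y, f (inl y) == v].
  apply: leq_trans (le3 (inl y) (inr true) (inr false)).
  apply/subset_leq_card/subsetP=> -[x|[]]; rewrite !inE ?eqxx ?orbT //.
  by rewrite -fy => /eqP/(injf x y)->; rewrite eqxx.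
apply: leq_trans (le3 (inr true) (inr true) (inr false)).
apply/subset_leq_card/subsetP=> -[x|[]]; rewrite !inE ?eqxx ?orbT //.
by move=> xv; case/existsP: no; exists x.
Qed.

(** * Operations inside the old graph commute with attaching *)

Section Commute.
Variables (G0 : sgraph) (a b : G0).
Hypothesis ab : a != b.

Lemma attached_val k (S : {set G0}) (a' b' x : del_vertices S) s :
  attached k a' b' s x = attached k (val a') (val b') s (val x).
Proof. by rewrite /attached !(inj_eq val_inj); case: s; rewrite (inj_eq val_inj). Qed.

Lemma attach_del_vertex_sub k (u : G0) (a' b' : del_vertices [set u]) :
  val a' = a -> val b' = b ->
  mmw_le2 (del_vertices [set (inl u : attach k a b)]) ->
  mmw_le2 (attach k a' b').
Proof.
move=> ea eb.
have pl (x : del_vertices [set u]) : (inl (val x) : attach k a b) \in ~: [set inl u].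
  by have := valP x; rewrite !inE.
have pr (s : bool) : (inr s : attach k a b) \in ~: [set inl u] by rewrite !inE.
pose f (x : attach k a' b') : del_vertices [set (inl u : attach k a b)] :=
  match x with
  | inl y => exist (fun z => z \in ~: [set inl u]) (inl (val y)) (pl y)
  | inr s => exist (fun z => z \in ~: [set inl u]) (inr s) (pr s)
  end.
apply: (mmw_le2_hom (f := f)).
  move=> [x|s] [y|t] // /(congr1 val) /= []; first by move/val_inj->.
  by move->.
by move=> [x|s] [y|t] //=; rewrite attached_val ea eb.
Qed.

Lemma attach_del_vertex_super k (u : G0) (a' b' : del_vertices [set u]) :
  val a' = a -> val b' = b -> mmw_le2 (attach k a' b') ->
  mmw_le2 (del_vertices [set (inl u : attach k a b)]).
Proof.
move=> ea eb.
pose f (x : del_vertices [set (inl u : attach k a b)]) : attach k a' b' :=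
  match val x with inl y => inl (insubd a' y) | inr s => inr s end.
have vf (x : G0) : (inl x : attach k a b) \in ~: [set inl u] -> val (insubd a' x) = x.
  by move=> xu; rewrite val_insubd ifT // !inE; move: xu; rewrite !inE.
apply: (mmw_le2_hom (f := f)).
  move=> [x px] [y py] e; apply: val_inj => /=; move: e; rewrite /f /=.
  case: x px => [x|s] px; case: y py => [y|t] py //.
    by case=> /(congr1 val); rewrite !vf // => ->.
  by case=> ->.
move=> [x px] [y py]; rewrite /f /= /induced_rel /=.
case: x px => [x|s] px; case: y py => [y|t] py //=.
- by rewrite /induced_rel /= !vf.
- by rewrite attached_val vf // ea eb.
- by rewrite attached_val vf // ea eb.
Qed.

Lemma attach_del_edge k (u v : G0) (x y : G0 + bool) :
  edge (x : attach k (a : del_edge u v) b) y =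
  edge (x : del_edge (inl u : attach k a b) (inl v)) y.
Proof.
case: x y => [x|s] [y|t] //=; rewrite /del_edge_rel /= ?andbT //.
- congr (_ && ~~ _); apply/eqP/eqP => e.
    by rewrite -!imset_set1 -!imsetU e.
  have inj : injective (@inl G0 bool) by move=> ? ? [].
  by apply: (imset_inj inj); rewrite !imsetU !imset_set1.
- rewrite [X in _ = _ && X](_ : _ = true) ?andbT //; apply/eqP=> /setP/(_ (inr t)).
  by rewrite !inE eqxx orbT.
- rewrite [X in _ = _ && X](_ : _ = true) ?andbT //; apply/eqP=> /setP/(_ (inr s)).
  by rewrite !inE eqxx.
- rewrite [X in _ = _ && X](_ : _ = true) ?andbT //; apply/eqP=> /setP/(_ (inr s)).
  by rewrite !inE eqxx.
Qed.

Section Contract.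
Variables (u v : G0) (uv : u -- v).

Let uv_neq : u != v.
Proof. by apply: contraTneq uv => ->; rewrite edge_irr. Qed.

Fact merge_in (x : G0) : (if x == v then u else x) \in [set~ v].
Proof. by rewrite !inE; case: (eqVneq x v). Qed.

Definition merge (x : G0) : contract u v :=
  exist (fun z => z \in [set~ v]) _ (merge_in x).

Lemma eq_merge (x : contract u v) z :
  (x == merge z) = (val x == z) || ((val x == u) && (z == v)).
Proof.
rewrite -(inj_eq val_inj) /=; have := valP x; rewrite !inE => xv.
by case: (eqVneq z v) => [->|_]; rewrite ?(negPf xv) ?andbT ?andbF ?orbF.
Qed.

Lemma attached_merge k s (x : contract u v) :
  attached k (merge a) (merge b) s x =
  attached k a b s (val x) || ((val x == u) && attached k a b s v).
Proof.
rewrite /attached; case: k; last by case: s; rewrite eq_merge [v == _]eq_sym.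
rewrite !eq_merge ![v == _]eq_sym.
by case: (val x == a); case: (val x == b); case: (val x == u); case: (a == v);
  case: (b == v).
Qed.

Lemma attach_contract_sub k :
  mmw_le2 (contract (inl u : attach k a b) (inl v)) ->
  mmw_le2 (attach k (merge a) (merge b)).
Proof.
have pl (x : contract u v) : (inl (val x) : attach k a b) \in [set~ inl v].
  by have := valP x; rewrite !inE.
have pr (s : bool) : (inr s : attach k a b) \in [set~ inl v] by rewrite !inE.
pose f (x : attach k (merge a) (merge b)) : contract (inl u : attach k a b) (inl v) :=
  match x with
  | inl y => exist (fun z => z \in [set~ inl v]) (inl (val y)) (pl y)
  | inr s => exist (fun z => z \in [set~ inl v]) (inr s) (pr s)
  end.
have injf : injective f.
  move=> [x|s] [y|t] // /(congr1 val) /= []; first by move/val_inj->.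
  by move->.
apply: (mmw_le2_hom injf) => x y xy; apply/andP; split.
  by rewrite (inj_eq injf); apply: contraTneq xy => ->; rewrite edge_irr.
move: x y xy => [x|s] [y|t] //=.
- by case/andP=> _; rewrite /eq_op /=.
- by rewrite attached_merge => /orP[->//|/andP[/eqP-> ->]]; rewrite eqxx !orbT.
- by rewrite attached_merge => /orP[->//|/andP[/eqP-> ->]]; rewrite eqxx !orbT.
- by move->.
Qed.

Lemma attach_contract_super k : mmw_le2 (attach k (merge a) (merge b)) ->
  mmw_le2 (contract (inl u : attach k a b) (inl v)).
Proof.
pose f (x : contract (inl u : attach k a b) (inl v)) : attach k (merge a) (merge b) :=
  match val x with inl y => inl (insubd (merge a) y) | inr s => inr s end.
have vf (x : G0) : (inl x : attach k a b) \in [set~ inl v] -> val (insubd (merge a) x) = x.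
  by move=> xu; rewrite val_insubd ifT // !inE; move: xu; rewrite !inE.
have injf : injective f.
  move=> [x px] [y py] e; apply: val_inj => /=; move: e; rewrite /f /=.
  case: x px => [x|s] px; case: y py => [y|t] py //.
    by case=> /(congr1 val); rewrite !vf // => ->.
  by case=> ->.
apply: (mmw_le2_hom injf) => x y /andP[]; rewrite -(inj_eq injf).
case: x y => [x px] [y py]; rewrite /f /=.
case: x px => [x|s] px; case: y py => [y|t] py //= ne.
- rewrite /contract_rel /= !vf // => h; apply/andP; split; first exact: ne.
  by move: h; rewrite /eq_op /=.
- rewrite attached_merge vf // => /or3P[->//|/andP[/eqP e h]|//].
  by case: e => ->; rewrite eqxx h orbT.
- by rewrite attached_merge vf.
- by rewrite !orbF.
Qed.

(** Non-adjacency of [a] and [b] enters here: contracting an edge [uv] identifies only its two ends,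
    so [a] and [b] stay distinct as [attach_core] requires. *)
Lemma merge_neq : ~~ (a -- b) -> merge a != merge b.
Proof.
move=> nab; rewrite eq_merge /=; have [ea|na] := eqVneq a v.
  have [ub|nub] := eqVneq u b; first by rewrite ea -ub edge_sym uv in nab.
  by rewrite eqxx /= -ea eq_sym (negPf ab).
rewrite (negPf ab) /=; apply/negP=> /andP[/eqP au /eqP bv].
by rewrite au bv uv in nab.
Qed.

End Contract.

End Commute.

Lemma bool_neq2 (s t r : bool) : t != s -> r != s -> t = r.
Proof. by case: s t r => [] [] []. Qed.

(** * The single steps of one attachment, from those of the other *)

Section Switch.
Variables (G0 : sgraph) (a b : G0).
Hypotheses (ab : a != b) (nab : ~~ (a -- b)).
Variables k k' : bool.
Hypothesis steps' : forall F, minor_step (attach k' a b) F -> mmw_le2 F.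
Hypothesis large' : ~ mmw_le2 (attach k' a b).

Let no_core : ~ core a b.
Proof. by move/(core_attach k')/large'. Qed.

Let endsP x : (x \in [set a; b]) = (x == a) || (x == b).
Proof. by rewrite !inE. Qed.

(** One step of the other attachment contains this graph: deleting one of the twin vertices, or
    contracting the middle edge of the path. *)
Let bypassK : mmw_le2 (bypass false a b).
Proof.
have [tw|tw] := boolP k'.
  have pl (x : option G0) : (if x is Some y then inl y else inr true : attach k' a b)
      \in ~: [set inr false] by case: x => [x|]; rewrite !inE.
  pose f (x : bypass false a b) : del_vertices [set (inr false : attach k' a b)] :=
    exist (fun z => z \in ~: [set inr false]) _ (pl x).
  have injf : injective f by move=> [x|] [y|] // /(congr1 val) // [->].
  apply: (mmw_le2_hom injf); last exact/steps'/StepDelVertex.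
  move=> [x|] [y|] //=; rewrite /induced_rel /= ?orbF // /attached tw endsP //.
have pl (x : option G0) : (if x is Some y then inl y else inr true : attach k' a b)
    \in [set~ inr false] by case: x => [x|]; rewrite !inE.
pose f (x : bypass false a b) : contract (inr true : attach k' a b) (inr false) :=
  exist (fun z => z \in [set~ inr false]) _ (pl x).
have injf : injective f by move=> [x|] [y|] // /(congr1 val) // [->].
apply: (mmw_le2_hom injf); last first.
  by apply/steps'/StepContract; rewrite /= tw.
move=> x y xy; apply/andP; split.
  by rewrite (inj_eq injf); apply: contraTneq xy => ->; rewrite edge_irr.
move: x y xy => [x|] [y|] //=; rewrite ?orbF ?endsP // /attached (negPf tw).
- by [].
- by [].
Qed.

Let bypassL : mmw_le2 (bypass true a b).
Proof. exact: bypass_chord. Qed.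

(** [core] does not depend on how the new vertices are attached, so it links the two attachments. *)
Let switch_old (G1 : sgraph) (a1 b1 : G1) : a1 != b1 ->
  mmw_le2 (attach k' a1 b1) -> mmw_le2 (attach k a1 b1).
Proof. by move=> ab1 /(attach_core ab1)/(core_attach k). Qed.

(** Without the end [u], the new vertices have no old neighbour but [w]; they are folded onto
    [w]. *)
Let del_end u w : attached true a b true u -> attached true a b true w -> u != w ->
  mmw_le2 (del_vertices [set (inl u : attach k a b)]).
Proof.
move=> ue we uw.
have wu : (inl w : attach k' a b) \in ~: [set inl u] by rewrite !inE eq_sym.
pose f (x : del_vertices [set (inl u : attach k a b)]) :
    del_vertices [set (inl u : attach k' a b)] :=
  if val x is inl _ then x else exist (fun z => z \in ~: [set inl u]) (inl w) wu.
pose Rep := [set x : del_vertices [set (inl u : attach k a b)] |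
  if val x is inl _ then true else false].
apply: (@mmw_le2_blowup _ _ f Rep); last exact/steps'/StepDelVertex.
- by move=> [[x|s] px] [[y|t] py]; rewrite !inE.
- move=> v; rewrite -(card_imset _ val_inj).
  pose h (z : G0 + bool) := if z is inl _ then z else inl w.
  apply: leq_trans (_ : #|h @^-1: [set val v]| <= 3); last first.
    by apply: card_fibre3 => x y [].
  apply/subset_leq_card/subsetP=> _ /imsetP[[[x|s] px] + ->].
    by rewrite !inE => /eqP <-.
  by rewrite !inE => /eqP <-.
- have ends z : z != u -> (z == a) || (z == b) -> z = w.
    move: ue we uw; rewrite /attached => /orP[]/eqP-> /orP[]/eqP->; rewrite ?eqxx //.
      by move=> _ /negPf->; move/eqP.
    by move=> _ /negPf->; rewrite orbF => /eqP.
  have px_neq z (pz : (inl z : attach k a b) \in ~: [set inl u]) : z != u.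
    by move: pz; rewrite !inE.
  move=> [[x|s] px] [[y|t] py] //=; rewrite /induced_rel /f /=.
  + by move=> xy _; rewrite !inE.
  + move=> /attached_ends /(ends _ (px_neq _ px)) e; rewrite -(inj_eq val_inj) /=.
    by case/eqP; rewrite e.
  + move=> /attached_ends /(ends _ (px_neq _ py)) e; rewrite -(inj_eq val_inj) /=.
    by case/eqP; rewrite e.
  + by move=> _; rewrite eqxx.
Qed.

Let del_new (s : bool) : mmw_le2 (del_vertices [set (inr s : attach k a b)]).
Proof.
pose f (x : del_vertices [set (inr s : attach k a b)]) : bypass false a b :=
  if val x is inl y then Some y else None.
apply: (@mmw_le2_hom _ _ f) bypassK.
  move=> [[x|t] px] [[y|t'] py]; rewrite /f //= => e; apply: val_inj => //=.
    by case: e => ->.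
  by move: px py; rewrite !inE => ts ts'; rewrite (bool_neq2 ts ts').
move=> [[x|t] px] [[y|t'] py] //=; rewrite /induced_rel /= ?orbF // ?endsP.
- exact: attached_ends.
- exact: attached_ends.
- move: px py; rewrite !inE => ts ts'.
  by rewrite (bool_neq2 ts ts') eqxx andbF.
Qed.

Let contract_onto (u v : attach k a b) (f : G0 + bool -> bypass true a b) :
  (forall x y, x != v -> y != v -> f x = f y -> x = y) ->
  (forall x y, x != v -> y != v -> x != y ->
     [|| edge (x : attach k a b) y, (x == u) && edge v y | (y == u) && edge v x] ->
     edge (f x) (f y)) ->
  mmw_le2 (contract u v).
Proof.
move=> injf hf.
have nv (x : contract u v) : val x != v by have := valP x; rewrite !inE.
apply: (@mmw_le2_hom _ (contract u v) (fun x => f (val x))) bypassL.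
  by move=> x y e; apply: val_inj; apply: injf e; exact: nv.
move=> x y /andP[ne h]; apply: hf => //; exact: nv.
Qed.

Let chordP x y : x != y -> (x == a) || (x == b) -> (y == a) || (y == b) ->
  edge (Some x : bypass true a b) (Some y).
Proof. by move=> xy xe ye; rewrite /= xy !endsP xe ye orbT. Qed.

(** The other new vertex becomes [None]. An edge that [u] gains towards an old vertex is the
    chord. *)
Let contract_new (u : G0) (s : bool) : attached k a b s u ->
  mmw_le2 (contract (inl u : attach k a b) (inr s)).
Proof.
move=> us; apply: (@contract_onto _ _ (fun x => if x is inl y then Some y else None)).
  move=> [x|t] [y|t'] //; first by move=> _ _ [->].
  move=> ts ts' _; have e : t != s -> t' != s -> t = t' := @bool_neq2 s t t'.
  by rewrite e.
have ue := attached_ends us.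
move=> [x|t] [y|t'] xs ys xy.
- have xy' : x != y by apply: contra_neq xy => ->.
  case/or3P=> [h|/andP[/eqP[xu] h]|/andP[/eqP[yu] h]].
  + by rewrite /= [x -- y]h.
  + by apply: chordP; rewrite // ?xu ?(attached_ends h).
  + by apply: chordP; rewrite // ?yu ?(attached_ends h).
- move=> h; rewrite /= endsP; case/or3P: h => [/attached_ends//|/andP[/eqP[->]] //|/andP[]//].
- move=> h; rewrite /= endsP; case/or3P: h => [/attached_ends//|/andP[]//|/andP[/eqP[->]] //].
- have xs' : t != s by []. have ys' : t' != s by [].
  by rewrite (bool_neq2 xs' ys') eqxx in xy.
Qed.

(** The surviving vertex [inr s] takes the place of [u]. *)
Let contract_old (u : G0) (s : bool) : attached k a b s u ->
  mmw_le2 (contract (inr s : attach k a b) (inl u)).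
Proof.
move=> us; pose f (x : G0 + bool) : bypass true a b :=
  match x with inl y => Some y | inr t => if t == s then Some u else None end.
have ue := attached_ends us.
apply: (@contract_onto _ _ f).
  move=> [x|t] [y|t'] xu yu /=; first by case=> ->.
  - by case: eqP => // _ [xe]; rewrite xe eqxx in xu.
  - by case: eqP => // _ [ye]; rewrite -ye eqxx in yu.
  - have [->|ts] := eqVneq t s; have [->|ts'] := eqVneq t' s => // _.
    by rewrite (bool_neq2 ts ts').
move=> [x|t] [y|t'] xu yu xy.
- by case/or3P=> [h|/andP[]//|/andP[]//]; rewrite /= [x -- y]h.
- have xu' : x != u by apply: contra_neq xu => ->.
  rewrite /f; have [->|ts] := eqVneq t' s.
    case/or3P=> [/attached_ends xe|/andP[]//|/andP[_ h]]; first exact: chordP.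
    by rewrite /= edge_sym [u -- x]h.
  case/or3P=> [/attached_ends xe|/andP[]//|/andP[/eqP[e]]]; first by rewrite /= endsP.
  by rewrite e eqxx in ts.
- have yu' : u != y by apply: contra_neq yu => ->.
  rewrite /f; have [->|ts] := eqVneq t s.
    case/or3P=> [/attached_ends xe|/andP[_ h]|/andP[]//]; first exact: chordP.
    by rewrite /= [u -- y]h.
  case/or3P=> [/attached_ends xe|/andP[/eqP[e]]|/andP[]//]; first by rewrite /= endsP.
  by rewrite e eqxx in ts.
- move=> _; have {}xy : t != t' by apply: contra_neq xy => ->.
  rewrite /f; have [ts|ts] := eqVneq t s; have [ts'|ts'] := eqVneq t' s.
  + by rewrite ts ts' eqxx in xy.
  + by rewrite /= endsP.
  + by rewrite /= endsP.
  + by rewrite (bool_neq2 ts ts') eqxx in xy.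
Qed.

(** The merged vertex becomes the middle vertex [None]. *)
Let contract_both (s t : bool) : s != t ->
  mmw_le2 (contract (inr s : attach k a b) (inr t)).
Proof.
move=> st; apply: (@contract_onto _ _ (fun x => if x is inl y then Some y else None)).
  move=> [x|r] [y|r'] //; first by move=> _ _ [->].
  move=> rt rt' _; have e : r != t -> r' != t -> r = r' := @bool_neq2 t r r'.
  by rewrite e.
move=> [x|r] [y|r'] xs ys xy.
- by case/or3P=> [h|/andP[]//|/andP[]//]; rewrite /= [x -- y]h.
- by move=> h; rewrite /= endsP; case/or3P: h
    => [/attached_ends|/andP[]|/andP[_ /attached_ends]].
- by move=> h; rewrite /= endsP; case/or3P: h
    => [/attached_ends|/andP[_ /attached_ends]|/andP[]].
- have xs' : r != t by []. have ys' : r' != t by [].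
  by rewrite (bool_neq2 xs' ys') eqxx in xy.
Qed.

(** The map [p] places the new vertices. Those in [Rep] represent the middle vertex [None]; the
    others are pendant pieces, folded onto the vertex where they hang. *)
Let del_edge_onto (u v : attach k a b) (p : bool -> option G0) (Rep : pred bool) :
  (forall s t, Rep s -> Rep t -> p s = p t -> s = t) ->
  (forall s, Rep s -> p s = None) ->
  (forall s x, attached k a b s x -> [set inl x; inr s] != [set u; v] ->
     p s = Some x \/ Rep s) ->
  (~~ k -> [set inr true; inr false] != [set u; v] -> p true = p false) ->
  mmw_le2 (del_edge u v).
Proof.
move=> injp pN old new.
pose f (x : del_edge u v) : bypass false a b := match x with inl y => Some y | inr s => p s end.
apply: (@mmw_le2_blowup _ _ f [set x | if x is inr s then Rep s else true]) bypassK.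
- move=> [x|s] [y|t]; rewrite !inE /= => h1 h2.
  + by case=> ->.
  + by rewrite pN.
  + by rewrite pN.
  + by move/(injp _ _ h1 h2)->.
- by move=> v'; apply: card_fibre3 => x y [].
have side s x : attached k a b s x -> [set inl x; inr s] != [set u; v] ->
    f (inl x) != f (inr s) -> Rep s /\ x \in [set a; b].
  move=> xs ne; have [e|rs _] := old s x xs ne; first by rewrite /= e eqxx.
  by rewrite endsP (attached_ends xs).
move=> [x|s] [y|t] /andP[xy ne] nf; rewrite !inE.
- by rewrite /= orbF.
- by have [rs xe] := side _ _ xy ne nf; rewrite rs /= pN.
- rewrite setUC in ne; rewrite eq_sym in nf.
  by have [rs xe] := side _ _ xy ne nf; rewrite rs /= pN.
- case/andP: xy => nk st; case/negP: nf; apply/eqP=> /=.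
  case: s t st ne => [] [] // _ ne; first exact: new.
  by apply/esym/new; rewrite // setUC.
Qed.

Let set2_inlr (x y : G0) (s t : bool) :
  ([set inl x; inr s] == [set inl y; inr t] :> {set G0 + bool}) = (x == y) && (s == t).
Proof.
apply/eqP/andP => [e|[/eqP-> /eqP->]//]; split.
  have : inl x \in [set inl y; inr t] by rewrite -e !inE eqxx.
  by rewrite !inE orbF.
have : inr s \in [set inl y; inr t] by rewrite -e !inE eqxx orbT.
by rewrite !inE.
Qed.

Let del_edge_new (u : G0) (s : bool) : attached k a b s u ->
  mmw_le2 (del_edge (inl u : attach k a b) (inr s)).
Proof.
move=> us; have [tw|tw] := orP (orbN k).
  (* After the deletion the twin vertex [s] hangs only on the other end [w]. *)
  pose w := if u == a then b else a.
  apply: (@del_edge_onto _ _ (fun t => if t == s then Some w else None)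
    (fun t => t != s)).
  - by case: s {us} => [] [] [].
  - by move=> t /negPf->.
  - move=> t x xt ne; have [ets|_] := eqVneq t s; [left|by right].
    move: xt us ne; rewrite ets set2_inlr eqxx andbT /attached tw /w.
    move=> /orP[]/eqP-> /orP[]/eqP-> //; rewrite ?eqxx //.
    by move=> /negPf ba; rewrite [b == a]eq_sym (negPf ab).
  - by rewrite tw.
(* On the path, [s] now hangs only on the other new vertex, so both go to [None]. *)
apply: (@del_edge_onto _ _ (fun=> None) (fun t => t != s)) => //.
- by case: s {us} => [] [] [].
- move=> t x xt ne; right; apply: contra_neq ne => ts.
  move: xt us; rewrite ts /attached (negPf tw) => /eqP-> /eqP->; by [].
Qed.

Let del_edge_both (s t : bool) : edge (inr s : attach k a b) (inr t) ->
  mmw_le2 (del_edge (inr s : attach k a b) (inr t)).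
Proof.
case/andP=> nk st.
(* Cutting the middle edge leaves one vertex hanging on [a] and one on [b]. *)
apply: (@del_edge_onto _ _ (fun r => Some (if r then a else b)) pred0) => //.
- by move=> r x; rewrite /attached (negPf nk) => /eqP-> _; left.
- move=> _ /negP[]; apply/eqP; case: s t st => [] [] // _.
  by rewrite setUC.
Qed.

Let del_edgeC (F : sgraph) (u v : F) : mmw_le2 (del_edge u v) -> mmw_le2 (del_edge v u).
Proof.
apply: (@mmw_le2_hom (del_edge u v) (del_edge v u) (fun x : F => x)) => // x y.
by rewrite /= /del_edge_rel /= [[set v; u]]setUC.
Qed.

Lemma attach_steps F : minor_step (attach k a b) F -> mmw_le2 F.
Proof.
case=> [[u|s]|[u|s] [v|t] uv|[u|s] [v|t] uv].
- have [ua|ua] := eqVneq u a.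
    by apply: (@del_end u b); rewrite /attached ?ua ?eqxx ?orbT.
  have [ub|ub] := eqVneq u b.
    by apply: (@del_end u a); rewrite /attached ?ub ?eqxx ?orbT // eq_sym.
  have pa : a \in ~: [set u] by rewrite !inE eq_sym.
  have pb : b \in ~: [set u] by rewrite !inE eq_sym.
  pose a' : del_vertices [set u] := exist (fun z => z \in ~: [set u]) a pa.
  pose b' : del_vertices [set u] := exist (fun z => z \in ~: [set u]) b pb.
  apply: (@attach_del_vertex_super _ _ _ _ _ a' b') => //.
  apply: switch_old; first by rewrite -(inj_eq val_inj).
  by apply: (@attach_del_vertex_sub _ _ _ _ _ a' b') => //; apply/steps'/StepDelVertex.
- exact: del_new.
- apply: (@mmw_le2_hom (attach k (a : del_edge u v) b)
    (del_edge (inl u : attach k a b) (inl v)) (fun x : G0 + bool => x)) => //.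
    by move=> x y; rewrite -attach_del_edge.
  apply: switch_old => //.
  apply: (@mmw_le2_hom (del_edge (inl u : attach k' a b) (inl v))
    (attach k' (a : del_edge u v) b) (fun x : G0 + bool => x)) => //.
    by move=> x y; rewrite -attach_del_edge.
  exact/steps'/StepDelEdge.
- exact: del_edge_new.
- exact/del_edgeC/del_edge_new.
- exact: del_edge_both.
- have uv' : u -- v by [].
  apply: (attach_contract_super (uv := uv')); apply: switch_old.
    exact: merge_neq.
  by apply: attach_contract_sub; apply/steps'/StepContract.
- exact: contract_new.
- exact: contract_old.
- by apply: contract_both; case/andP: uv.
Qed.

End Switch.

(** * Assembling the theorem *)

Lemma step_minimal_attach (G0 : sgraph) (a b : G0) k k' : a != b -> ~~ (a -- b) ->
  step_minimal (attach k' a b) -> step_minimal (attach k a b).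
Proof.
move=> ab nab [large steps]; split; last exact: attach_steps steps large.
by move/(attach_core ab)/(core_attach k').
Qed.

Lemma not_kconnected3 (F : sgraph) (x y u v : F) : x != y -> x != u -> x != v ->
  y != u -> y != v -> (forall z, x -- z -> z \in [set u; v]) -> ~ kconnected 3 F.
Proof.
move=> xy xu xv yu yv nx [_ /(_ [set u; v])].
have -> : #|[set u; v]| < 3 by rewrite cards2; case: (_ != _).
case=> // _ con.
have px : x \in ~: [set u; v] by rewrite !inE negb_or xu.
have py : y \in ~: [set u; v] by rewrite !inE negb_or yu.
have /connectP[[|z p]] := con (exist _ x px : del_vertices [set u; v]) (exist _ y py).
  by move=> _ [yx]; rewrite yx eqxx in xy.
move=> /= /andP[xz _] _; have := nx (val z) xz.
by have := valP z; rewrite !inE => /negPf->.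
Qed.

Theorem lemma3p9 (G : sgraph) (a b c d : G)
  (path_acdb : induced_path [:: a; c; d; b])
  (nbr_c : forall x : G, c -- x -> x \in [:: a; d])
  (nbr_d : forall x : G, d -- x -> x \in [:: c; b]) :
  (minor_minimal_mmw3 G /\ ~ kconnected 3 G) <->
  (minor_minimal_mmw3 (replace_by_two_paths a b c d) /\
   ~ kconnected 3 (replace_by_two_paths a b c d)).
Proof.
have [uq ind] := path_acdb.
move: uq; rewrite /= !inE !negb_or !andbT => /and3P[/and3P[ac ad ab] /andP[cd cb] db].
have [ca da ba] : [/\ c != a, d != a & b != a] by rewrite ![_ == a]eq_sym.
have [dc bc bd] : [/\ d != c, b != c & b != d] by rewrite ![_ == c]eq_sym [b == d]eq_sym.
have Eac : a -- c by rewrite ind ?inE ?eqxx ?orbT //= eqxx (negPf ac) eqxx.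
have Ecd : c -- d.
  by rewrite ind ?inE ?eqxx ?orbT //= eqxx (negPf ac) (negPf ad) (negPf cd) eqxx.
have Edb : d -- b.
  by rewrite ind ?inE ?eqxx ?orbT //= !eqxx (negPf ad) (negPf cd)
    (negPf ab) (negPf cb) (negPf db).
(* [a] and [b] are not consecutive on an induced path. *)
have nab : ~~ (a -- b).
  by rewrite ind ?inE ?eqxx ?orbT //= !eqxx (negPf ab) (negPf cb) (negPf db).
have pa : a \in ~: [set c; d] by rewrite !inE negb_or ac.
have pb : b \in ~: [set c; d] by rewrite !inE negb_or bc.
pose G0 := del_vertices [set c; d].
pose a0 : G0 := exist (fun z => z \in ~: [set c; d]) a pa.
pose b0 : G0 := exist (fun z => z \in ~: [set c; d]) b pb.
have ab0 : a0 != b0 by rewrite -(inj_eq val_inj).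
have nab0 : ~~ (a0 -- b0) by [].
pose H := replace_by_two_paths a b c d.
have nkG : ~ kconnected 3 G.
  apply: (@not_kconnected3 G c b a d) => // z /nbr_c.
  by rewrite !inE.
have nkH : ~ kconnected 3 H.
  apply: (@not_kconnected3 H (inr true) (inr false) (inl a0) (inl b0)) => // -[x|//] /=.
  by move=> /set2P[] e; apply/set2P; [left|right]; congr inl; apply: val_inj.
(* The two graphs share their vertices, so the identity is an isomorphism. *)
have isoH (u v : G0 + bool) : edge (u : H) v = edge (u : attach true a0 b0) v.
  by case: u v => [x|s] [y|t] //=; rewrite /attached -!(inj_eq val_inj) !inE.
have minH : step_minimal H <-> step_minimal (attach true a0 b0).
  pose id0 (x : G0 + bool) := x; have injid : injective id0 by [].
  by split; [apply: (@step_minimal_hom H (attach true a0 b0) id0 id0)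
            |apply: (@step_minimal_hom (attach true a0 b0) H id0 id0)] => //;
    move=> x y; rewrite isoH.
have n0 (x : G0) : (val x != c) /\ (val x != d).
  by have := valP x; rewrite !inE negb_or => /andP[].
(* [G] is the single-path attachment with [c] and [d] as new vertices; the restrictions on their
   neighbours make [h] reflect edges. *)
pose h (x : attach false a0 b0) : G :=
  match x with inl y => val y | inr s => if s then c else d end.
pose g (x : G) : attach false a0 b0 :=
  if x == c then inr true else if x == d then inr false else inl (insubd a0 x).
have hK : cancel g h.
  move=> x; rewrite /g; have [->//|xc] := eqVneq x c; have [->//|xd] := eqVneq x d.
  by rewrite /h val_insubd !inE negb_or xc xd.
have gK : cancel h g.
  move=> [x|s]; rewrite /g /=; last by case: s; rewrite ?eqxx // (negPf dc).
  by have [/negPf-> /negPf->] := n0 x; rewrite valKd.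
have isoG (u v : attach false a0 b0) : edge u v = (h u -- h v).
  have old (x : G0) s : attached false a0 b0 s x = val x -- (if s then c else d).
    rewrite /attached -(inj_eq val_inj); have [xc xd] := n0 x.
    apply/eqP/idP => [->|]; first by case: s; rewrite //= edge_sym.
    case: s; rewrite edge_sym; first by move/nbr_c; rewrite !inE (negPf xd) orbF => /eqP.
    by move/nbr_d; rewrite !inE (negPf xc) => /eqP.
  case: u v => [x|s] [y|t].
  - by [].
  - exact: old.
  - by rewrite edge_sym [RHS]edge_sym; exact: old.
  - by case: s t => [] []; rewrite /= ?edge_irr ?Ecd // edge_sym Ecd.
have minG : step_minimal G <-> step_minimal (attach false a0 b0).
  have hh x y : edge x y -> h x -- h y by rewrite isoG.
  have hg x y : x -- y -> edge (g x) (g y) by rewrite isoG !hK.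
  by split; [apply: step_minimal_hom (can_inj hK) hg (can_inj gK) hh
           |apply: step_minimal_hom (can_inj gK) hh (can_inj hK) hg].
split=> -[/minor_minimal_mmw3P mF _]; split=> //; apply/minor_minimal_mmw3P.
  by apply/minH; apply: (@step_minimal_attach _ _ _ true false) => //; apply/minG.
by apply/minG; apply: (@step_minimal_attach _ _ _ false true) => //; apply/minH.
Qed.
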